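(* Consider the Berstel sequence defined by $$B_0=B_1=0,\quad B_2=1,\qquad B_{n+3}=2B_{n+2}-4B_{n+1}+4B_n\quad\text{for } n\ge 0.$$ Let $p$ be a prime such that $p\nmid 2\cdot 3\cdot 11\cdot 13$. The following assertions are equivalent: \begin{enumerate} \item $B_p\equiv 0\pmod p$. \item $p=X^2+11Y^2$ for some $X,Y\in\mathbb{Z}$. \end{enumerate} *)

(* Defs.v *)
From mathcomp Require Import all_boot all_order all_algebra.

Set Implicit Arguments.
Unset Strict Implicit.
Unset Printing Implicit Defensive.

Import GRing.Theory.
Local Open Scope ring_scope.

Fixpoint berstel (n : nat) : int :=
  match n with
  | 0 | 1 => 0
  | 2 => 1
  | ((m.+1 as m1).+1 as m2).+1 =>
      2 * berstel m2 - 4 * berstel m1 + 4 * berstel m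
  end.

Lemma berstel0 : berstel 0 = 0. Proof. by []. Qed.

Lemma berstel1 : berstel 1 = 0. Proof. by []. Qed.

Lemma berstel2 : berstel 2 = 1. Proof. by []. Qed.

Lemma berstelSSS (n : nat) :
  berstel n.+3 = 2 * berstel n.+2 - 4 * berstel n.+1 + 4 * berstel n.
Proof. by []. Qed.

(* Main.v *)
(* Let [u v = -8] and [u ^ 3 = 26 + 6 sqrt 33]. By Cardano the roots of the
   characteristic polynomial are [(x u + x ^ 2 v + 2) / 3] with [x ^ 3 = 1], and
   [B p] is the coefficient of [X ^ 2] in [X ^ p] modulo that polynomial. So
   [B p = 0 mod p] says that Frobenius acts affinely on the roots, and a
   comparison of coefficients shows that it then fixes each of them.
   If -11 is a square mod [p], write [4 p = a ^ 2 + 11 b ^ 2] and substitute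
   [a / b] for [sqrt (-11)]: [(u / v) ^ 3] becomes the quotient of
   [epsilon = (13 b + 3 a sqrt (-3)) / 2] by its conjugate. Cubic reciprocity
   for a rational prime against [epsilon] (obtained from Gauss sums) turns the
   Frobenius condition into [(p / epsilon) = 1]. Since
   [N epsilon = 27 p - 32 b ^ 2], and primes dividing [a b] are cubic residues
   of [epsilon], this symbol equals [(2 / epsilon) ^ 2], which is trivial iff
   [a] is even, that is, iff [p = X ^ 2 + 11 Y ^ 2]. When [3] divides [b] the
   element [epsilon] is not primary and one uses
   [(11 b) ^ 2 + 11 a ^ 2 = 4 * 11 * p] instead. *)
Require Import Defs.
From mathcomp Require Import all_boot all_order all_algebra all_field.
From mathcomp Require Import ring zify.

Set Implicit Arguments.
Unset Strict Implicit.
Unset Printing Implicit Defensive.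

Import GRing.Theory Num.Theory.
Local Open Scope ring_scope.

Lemma closed_field_pchar (p : nat) :
  prime p -> exists F : closedFieldType, p \in [pchar F].
Proof.
move=> p_pr; have [F [f _]] := countable_algebraic_closure 'F_p.
by exists F; rewrite (fmorph_pchar f) pchar_Fp.
Qed.

(** * Gauss and Jacobi sums of cubic characters *)

Section GaussSums.

Variables (K : finFieldType) (F : fieldType).

(** The target field is arbitrary: Gauss sums are taken in characteristic 0 to find a norm, and in
    characteristic [p], where the [p]-th power is additive. *)
Definition cubic_character (chi : K -> F) : Prop :=
  [/\ {morph chi : x y / x * y}, chi 0 = 0,
      forall x, x != 0 -> chi x ^+ 3 = 1 & exists2 a, a != 0 & chi a != 1].

Definition jacobi_sum (chi : K -> F) : F := \sum_z chi z * chi (1 - z).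

Variable psi : K -> F.
Hypothesis psiD : {morph psi : x y / x + y >-> x * y}.
Hypothesis psi0 : psi 0 = 1.
Hypothesis sum_psi : \sum_x psi x = 0.

Definition gauss_sum (chi : K -> F) : F := \sum_x chi x * psi x.

Lemma cubic_character_sqr chi :
  cubic_character chi -> cubic_character (fun x => chi x ^+ 2).
Proof.
case=> chiM chi0 chi3 [a a0 chia]; split.
- by move=> x y; rewrite chiM exprMn.
- by rewrite chi0 expr0n.
- by move=> x x0; rewrite exprAC chi3 ?expr1n.
- exists a => //; apply: contra chia => /eqP chi2.
  by rewrite -(chi3 a a0) exprS chi2 mulr1.
Qed.

Lemma cubic_character_sqrK chi :
  cubic_character chi -> forall x, (chi x ^+ 2) ^+ 2 = chi x.
Proof.
case=> chiM chi0 chi3 _ x; have [->|x0] := eqVneq x 0.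
  by rewrite chi0 !expr0n.
by rewrite -exprM (exprD _ 3 1) chi3 // mul1r.
Qed.

Lemma cubic_characterN1 chi : cubic_character chi -> chi (-1) = 1.
Proof.
move=> chiP; have [chiM _ chi3 _] := chiP.
rewrite -[RHS](chi3 (-1)) ?oppr_eq0 ?oner_eq0 // !exprS expr0 mulr1 -!chiM.
by congr chi; ring.
Qed.

Lemma cubic_characterN chi x : cubic_character chi -> chi (- x) = chi x.
Proof.
move=> chiP; have [chiM _ _ _] := chiP.
by rewrite -mulN1r chiM cubic_characterN1 ?mul1r.
Qed.

Lemma sum_cubic_character chi : cubic_character chi -> \sum_x chi x = 0.
Proof.
case=> chiM _ _ [a a0 chia].
have : chi a * \sum_x chi x = \sum_x chi x.
  rewrite mulr_sumr [RHS](reindex (fun x => a * x)) /=; last first.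
    by exists (fun x => a^-1 * x) => x _; rewrite ?mulKf ?mulVKf.
  by apply: eq_bigr => x _; rewrite chiM.
move/eqP; rewrite -subr_eq0 -{2}[\sum_x _]mul1r -mulrBl mulf_eq0 subr_eq0.
by rewrite (negPf chia) => /eqP.
Qed.

Lemma sum_psi_scale a : \sum_x psi (a * x) = if a == 0 then #|K|%:R else 0.
Proof.
have [->|a0] := eqVneq.
  under eq_bigr do rewrite mul0r psi0.
  by rewrite sumr_const.
rewrite -[RHS]sum_psi [RHS](reindex (fun x => a * x)) //.
by exists (fun x => a^-1 * x) => x _; rewrite ?mulKf ?mulVKf.
Qed.

Lemma gauss_sum_mul chi1 chi2 :
  gauss_sum chi1 * gauss_sum chi2 =
  \sum_t psi t * \sum_x chi1 x * chi2 (t - x).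
Proof.
under [RHS]eq_bigr do rewrite mulr_sumr.
rewrite exchange_big /= /gauss_sum mulr_suml; apply: eq_bigr => x _.
rewrite mulr_sumr [RHS](reindex (fun y => y + x)) /=; last first.
  by exists (fun y => y - x) => y _; rewrite ?addrK ?subrK.
by apply: eq_bigr => y _; rewrite psiD addrK; ring.
Qed.

(** In the convolution the term [t = 0] is a sum of the nontrivial character [chi ^ 2], hence 0; for
    [t != 0] the substitution [x = t z] extracts [chi t ^ 2]. *)
Lemma gauss_sum_sqr chi : cubic_character chi ->
  gauss_sum chi ^+ 2 = jacobi_sum chi * gauss_sum (fun x => chi x ^+ 2).
Proof.
move=> chiP; have [chiM chi0 _ _] := chiP.
rewrite expr2 gauss_sum_mul /gauss_sum mulr_sumr; apply: eq_bigr => t _.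
rewrite mulrA mulrC; congr (_ * _).
have [->|t0] := eqVneq t 0.
  rewrite chi0 expr0n mulr0.
  under eq_bigr do rewrite sub0r cubic_characterN // -expr2.
  exact: sum_cubic_character (cubic_character_sqr chiP).
rewrite (reindex (fun x => t * x)) /=; last first.
  by exists (fun x => t^-1 * x) => x _; rewrite ?mulKf ?mulVKf.
rewrite /jacobi_sum mulr_suml; apply: eq_bigr => z _.
by rewrite -{2}[t]mulr1 -mulrBr !chiM; ring.
Qed.

(** After [x = z y] the inner sum over [y] is [#|K| - 1] at [z = -1] and [-1] elsewhere; the
    constant [-1] is killed by [\sum_z chi z = 0]. *)
Lemma gauss_sum_mul_sqr chi : cubic_character chi ->
  gauss_sum chi * gauss_sum (fun x => chi x ^+ 2) = #|K|%:R.
Proof.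
move=> chiP; have [chiM chi0 chi3 _] := chiP.
have -> : gauss_sum chi * gauss_sum (fun x => chi x ^+ 2) =
    \sum_z chi z * \sum_(y | y != 0) psi ((1 + z) * y).
  transitivity (\sum_(y | y != 0) \sum_z chi z * psi ((1 + z) * y)).
    rewrite /gauss_sum mulrC (bigD1 0) //= chi0 expr0n /= mul0r add0r.
    rewrite mulr_suml; apply: eq_bigr => y y0; rewrite mulr_sumr.
    rewrite (reindex (fun x => x * y)) /=; last first.
      by exists (fun x => x / y) => x _; rewrite ?mulfK ?mulfVK.
    apply: eq_bigr => z _; rewrite chiM mulrDl mul1r psiD.
    by rewrite -[RHS]mul1r -(chi3 y y0); ring.
  by rewrite exchange_big; apply: eq_bigr => z _; rewrite mulr_sumr.
have E z : \sum_(y | y != 0) psi ((1 + z) * y) =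
    (if z == -1 then #|K|%:R else 0) - 1.
  rewrite -addr_eq0 [z + 1]addrC -sum_psi_scale [in RHS](bigD1 0) //=.
  by rewrite mulr0 psi0 addrAC subrr add0r.
under eq_bigr do rewrite E mulrBr mulr1.
rewrite sumrB (sum_cubic_character chiP) subr0 (bigD1 (-1)) //= eqxx big1.
  by rewrite addr0 cubic_characterN1 // mul1r.
by move=> z /negPf ->; rewrite mulr0.
Qed.

(** Multiply [g ^ 2 = J g'] by [g' ^ 2 = J' g] and cancel [g g' = #|K|]. *)
Lemma jacobi_sum_norm chi : #|K|%:R != 0 :> F -> cubic_character chi ->
  jacobi_sum chi * jacobi_sum (fun x => chi x ^+ 2) = #|K|%:R.
Proof.
move=> q0 chiP; have chi2P := cubic_character_sqr chiP.
have gg := gauss_sum_mul_sqr chiP.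
have g1 := gauss_sum_sqr chiP; have := gauss_sum_sqr chi2P.
have -> : gauss_sum (fun x => (chi x ^+ 2) ^+ 2) = gauss_sum chi.
  by apply: eq_bigr => x _; rewrite cubic_character_sqrK.
move=> g2; apply: (mulIf q0); rewrite -{1}gg.
transitivity (gauss_sum chi ^+ 2 * gauss_sum (fun x => chi x ^+ 2) ^+ 2).
  by rewrite g1 g2; ring.
by rewrite -exprMn gg expr2.
Qed.

Lemma gauss_sum_cube chi : cubic_character chi ->
  gauss_sum chi ^+ 3 = #|K|%:R * jacobi_sum chi.
Proof.
move=> chiP; rewrite exprS gauss_sum_sqr // -(gauss_sum_mul_sqr chiP); ring.
Qed.

End GaussSums.

(** * Cubic characters modulo a prime *)

(** A discrete logarithm modulo 3. Its values involve no root of unity, so one index yields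
    characters into fields of every characteristic other than 3. *)
Definition cubic_index (K : fieldType) (ind : K -> nat) : Prop :=
  (forall x y, x != 0 -> y != 0 ->
     (ind (x * y)%R = ind x + ind y %[mod 3])%N) /\
  exists2 a, a != 0 & (ind a %% 3 != 0)%N.

Definition char_of_index (K F : fieldType) (ind : K -> nat) (w : F) (x : K) :=
  if x == 0 then 0 else w ^+ ind x.

Lemma cube_root1 (F : fieldType) (w : F) : w ^+ 2 + w + 1 = 0 -> w ^+ 3 = 1.
Proof.
move=> wP; apply/eqP; rewrite -subr_eq0; apply/eqP.
by transitivity ((w - 1) * (w ^+ 2 + w + 1)); [ring | rewrite wP mulr0].
Qed.

Lemma omega_sqrE (F : fieldType) (w : F) :
  w ^+ 2 + w + 1 = 0 -> w ^+ 2 = - w - 1.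
Proof. by move=> wP; apply/eqP; rewrite -subr_eq0 -wP; apply/eqP; ring. Qed.

Lemma prim3_root (F : fieldType) (w : F) :
  w ^+ 3 = 1 -> w != 1 -> 3.-primitive_root w.
Proof.
move=> w3 w1; have [m mP] := prim_order_exists (isT : (0 < 3)%N) w3.
rewrite dvdn_divisors // !inE => /orP[] /eqP m1; move: mP; rewrite m1 //.
by move/prim_expr_order; rewrite expr1 => /eqP; rewrite (negPf w1).
Qed.

Lemma omega_neq1 (F : fieldType) (w : F) :
  3%:R != 0 :> F -> w ^+ 2 + w + 1 = 0 -> w != 1.
Proof.
move=> n3; apply: contra_eq_neq => ->.
by rewrite (_ : _ + _ = 3%:R) //; ring.
Qed.

Lemma expr_cubic_index (K F : fieldType) (ind : K -> nat) (w : F) :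
  cubic_index ind -> w ^+ 3 = 1 ->
  forall x y, x != 0 -> y != 0 -> w ^+ ind (x * y) = w ^+ ind x * w ^+ ind y.
Proof.
move=> [indM _] w3 x y x0 y0.
by rewrite -exprD -(expr_mod _ w3) indM // expr_mod.
Qed.

Lemma char_of_indexP (K : finFieldType) (F : fieldType) (ind : K -> nat)
    (w : F) :
  cubic_index ind -> 3%:R != 0 :> F -> w ^+ 2 + w + 1 = 0 ->
  cubic_character (char_of_index ind w).
Proof.
move=> indP n3 wP; have w3 := cube_root1 wP; have w1 := omega_neq1 n3 wP.
rewrite /char_of_index; split=> [x y||x /negPf -> |].
- rewrite mulf_eq0; case: eqVneq => [|x0] /=; first by rewrite mul0r.
  case: eqVneq => [|y0] /=; first by rewrite mulr0.
  exact: expr_cubic_index.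
- by rewrite eqxx.
- by rewrite exprAC w3 expr1n.
- case: indP => _ [a a0 inda]; exists a => //; rewrite (negPf a0).
  by rewrite -(prim_order_dvd (prim3_root w3 w1)).
Qed.

Lemma cubic_index_exists (q : nat) : prime q -> (q %% 3 = 1)%N ->
  exists ind : 'F_q -> nat, cubic_index ind.
Proof.
move=> q_pr q1; set n := ((q - 1) %/ 3)%N.
have q_gt1 := prime_gt1 q_pr.
have qn : q = (n * 3).+1 by rewrite /n; lia.
have n_gt0 : (0 < n)%N by lia.
have fermat (x : 'F_q) : x != 0 -> x ^+ (n * 3) = 1.
  move=> x0; apply: (mulfI x0); rewrite -exprS -qn mulr1.
  by have := expf_card x; rewrite card_Fp.
have [a a0 an1] : exists2 a : 'F_q, a != 0 & a ^+ n != 1.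
  case: (pickP (fun a : 'F_q => (a != 0) && (a ^+ n != 1))) => [a|all1].
    by case/andP=> *; exists a.
  have p0 : 'X^n - 1%:P != 0 :> {poly 'F_q}.
    by rewrite -size_poly_eq0 size_XnsubC.
  suff : (size (enum (predC1 (0 : 'F_q)%R)) <
      size ('X^n - 1%:P : {poly 'F_q})%R)%N.
    by rewrite size_XnsubC // -cardE cardC1 card_Fp //; lia.
  apply: max_poly_roots p0 _ (enum_uniq _); apply/allP => x.
  rewrite mem_enum inE => x0; rewrite rootE !hornerE.
  by have := all1 x; rewrite x0 subr_eq0 /= => /negbFE.
set h := a ^+ n; have h3 : h ^+ 3 = 1 by rewrite -exprM fermat.
have hP : h ^+ 2 + h + 1 = 0.
  apply: (@mulfI _ (h - 1)); first by rewrite subr_eq0.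
  by rewrite mulr0; transitivity (h ^+ 3 - 1); [ring | rewrite h3 subrr].
(* For [x != 0], [x ^ n] is a cube root of unity, hence a power of [h]; the index is the
   exponent. *)
pose ind (x : 'F_q) : nat :=
  if x ^+ n == 1 then 0%N else if x ^+ n == h then 1%N else 2%N.
have indE (x : 'F_q) : x != 0 -> x ^+ n = h ^+ ind x.
  move=> x0; rewrite /ind; case: eqVneq => // x1; case: eqVneq => // xh.
  apply: (@mulfI _ ((x ^+ n - 1) * (x ^+ n - h))).
    by rewrite mulf_neq0 // subr_eq0.
  apply/eqP; rewrite -subr_eq0 -mulrBr; apply/eqP.
  transitivity (((x ^+ n) ^+ 3 - h ^+ 3)
    - (h ^+ 2 + h + 1) * x ^+ n * (x ^+ n - h)); first by ring.
  by rewrite -exprM fermat // h3 hP; ring.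
have hprim := prim3_root h3 an1.
exists ind; split=> [x y x0 y0|].
  apply/eqP; rewrite -(eq_prim_root_expr hprim) exprD -!indE ?mulf_neq0 //.
  by rewrite exprMn.
exists a => //; rewrite /ind (negPf an1).
by rewrite eqxx.
Qed.

(** * Integral coordinates of the cubic Jacobi sum *)

Section JacobiClasses.

Variables (K : finFieldType) (ind : K -> nat).
Hypothesis indP : cubic_index ind.

Definition jacobi_class (i : nat) : pred K :=
  [pred z | (z * (1 - z) != 0) && (ind (z * (1 - z))%R %% 3 == i)%N].

(* [z |-> 1 / (1 - z)] has order 3 and preserves each class, because
   [z (1 - z)] and its image differ by the cube of [z - 1]; its fixed points
   satisfy [z (1 - z) = 1] and lie in class 0. *)
Lemma dvdn_card_jacobi_class i : (i %% 3 != 0)%N -> (3 %| #|jacobi_class i|)%N.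
Proof.
move=> i0; have [indM _] := indP.
have ind1 : (ind 1%R = 0 %[mod 3])%N.
  have := indM 1 1 (oner_neq0 _) (oner_neq0 _).
  by rewrite mulr1; move: (ind 1) => k; lia.
have ind_cube y : y != 0 -> (ind (y * (y * y))%R = 0 %[mod 3])%N.
  move=> y0; have := indM y (y * y) y0 (mulf_neq0 y0 y0).
  have := indM y y y0 y0.
  by move: (ind _) (ind _) (ind y) => a b c; lia.
pose f (z : K) := (1 - z)^-1.
have f_inj : injective f by move=> x y /invr_inj /addrI /oppr_inj.
have fE z : z != 0 -> 1 - z != 0 ->
    z * (1 - z) = (f z * (1 - f z)) * ((z - 1) * ((z - 1) * (z - 1))).
  by move=> z0 z1; rewrite /f; field.
have fcl : fclosed f (jacobi_class i).
  move=> z _ /eqP <-; rewrite !inE.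
  have [->|z0] := eqVneq z 0.
    by rewrite /f subr0 invr1 subrr !(mul0r, mulr0) !eqxx.
  have [z1|z1] := eqVneq (1 - z) 0.
    by rewrite /f z1 invr0 !(mul0r, mulr0) !eqxx.
  have z1' : z - 1 != 0 by rewrite -opprB oppr_eq0.
  have E := fE z z0 z1.
  have nz : z * (1 - z) != 0 by rewrite mulf_neq0.
  have nfz : f z * (1 - f z) != 0.
    by apply: contraNneq nz => fz0; rewrite E fz0 mul0r.
  rewrite nz nfz /= {1}E; congr (_ == _).
  rewrite (indM _ _ nfz (mulf_neq0 z1' (mulf_neq0 z1' z1'))).
  have := ind_cube _ z1'; move: (ind _) (ind _) => a b; lia.
have ford : jacobi_class i \subset order_set f 3.
  apply/subsetP => z; rewrite inE => /andP[nz indz].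
  have [z0 z1] : z != 0 /\ 1 - z != 0.
    by move: nz; rewrite mulf_eq0 negb_or => /andP[].
  have z1' : z - 1 != 0 by rewrite -opprB oppr_eq0.
  have fffz : f (f (f z)) = z.
    rewrite /f; field; rewrite z1 /= [_ - (1 - z)](_ : _ = - 1); last by ring.
    by rewrite (_ : _ - 1 = - z) ?oppr_eq0 ?z0 ?oner_eq0 //; ring.
  have fz : f z != z.
    apply: contraTneq indz => fz; suff -> : z * (1 - z) = 1.
      by move: i0 ind1; lia.
    by rewrite -{1}fz mulVf.
  rewrite inE; apply/eqP.
  apply: (@order_cycle _ f [:: z; f z; f (f z)]); last by rewrite inE eqxx.
    by rewrite /= fffz !eqxx.
  have ffz : f (f z) != z.
    by apply: contra fz => /eqP ffz; rewrite -{2}fffz ffz.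
  rewrite /= !inE negb_or !(eq_sym _ (f (f z))) (inj_eq f_inj) fz ffz.
  by rewrite eq_sym fz.
by rewrite -(fcard_order_set f_inj ford fcl) dvdn_mull.
Qed.

(** The coordinates are independent of [F] and [w], so a relation between them proved in
    characteristic 0 can be used in characteristic [p]. By the preceding lemma the coefficient of
    [w] is a multiple of 3. *)
Lemma jacobi_sum_classes (F : fieldType) (w : F) : w ^+ 2 + w + 1 = 0 ->
  jacobi_sum (char_of_index ind w) =
  (#|jacobi_class 0|%:Z - #|jacobi_class 2|%:Z)%:~R
  + (#|jacobi_class 1|%:Z - #|jacobi_class 2|%:Z)%:~R * w.
Proof.
move=> wP; have w3 := cube_root1 wP.
have -> : jacobi_sum (char_of_index ind w) =
    \sum_z \sum_(i < 3) (z \in jacobi_class i)%:R * w ^+ i.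
  apply: eq_bigr => z _.
  have -> : char_of_index ind w z * char_of_index ind w (1 - z) =
      char_of_index ind w (z * (1 - z)).
    rewrite /char_of_index mulf_eq0; case: eqVneq => [|z0] /=.
      by rewrite mul0r.
    case: eqVneq => [|z1] /=; first by rewrite mulr0.
    by rewrite -expr_cubic_index.
  rewrite !big_ord_recr big_ord0 /= !inE /char_of_index.
  case: eqVneq => _ /=; first by rewrite !mul0r !addr0.
  rewrite -(expr_mod _ w3).
  have : (ind (z * (1 - z))%R %% 3 < 3)%N by rewrite ltn_mod.
  by case: (_ %% 3)%N => [|[|[|]]] //= _; ring.
rewrite exchange_big /= !big_ord_recr big_ord0 /=.
have cardE i : \sum_z (z \in jacobi_class i)%:R = #|jacobi_class i|%:R :> F.
  rewrite -sum1_card natr_sum [RHS]big_mkcond /=.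
  by apply: eq_bigr => z _; case: ifP.
rewrite -!mulr_suml !cardE !rmorphB /= -!pmulrn.
by rewrite (omega_sqrE wP); ring.
Qed.

End JacobiClasses.

Lemma omega_exists (F : closedFieldType) : exists w : F, w ^+ 2 + w + 1 = 0.
Proof.
have [|w wP] := @solve_monicpoly F 2 (fun=> -1); first by [].
by exists w; rewrite wP !big_ord_recr big_ord0 /=; ring.
Qed.

Lemma omega_sqr (F : fieldType) (w : F) :
  w ^+ 2 + w + 1 = 0 -> (w ^+ 2) ^+ 2 + w ^+ 2 + 1 = 0.
Proof.
move=> wP; transitivity ((w ^+ 2 + w + 1) * (w ^+ 2 - w + 1)); first by ring.
by rewrite wP mul0r.
Qed.

Lemma additive_character_exists (q : nat) (F : closedFieldType) :
  prime q -> exists psi : 'F_q -> F,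
  [/\ {morph psi : x y / x + y >-> x * y}, psi 0 = 1 & \sum_x psi x = 0].
Proof.
(* [m.+1] is the cardinal of ['F_q], so the equation for [z] says
   [1 + z + ... + z ^ (q - 1) = 0]. *)
move=> q_pr; set m := (Zp_trunc (pdiv q)).+1.
have [|z zP] := @solve_monicpoly F m (fun=> -1); first by [].
have sum_z : \sum_(i < m.+1) z ^+ i = 0.
  rewrite big_ord_recr /= zP -big_split big1 //= => i _.
  by rewrite mulN1r addrN.
have zm : z ^+ m.+1 = 1.
  by apply/eqP; rewrite -subr_eq0 subrX1 sum_z mulr0.
exists (fun x : 'F_q => z ^+ x); split=> // x y.
by rewrite -exprD /= expr_mod.
Qed.

(** * Cubic reciprocity for rational primes *)

Definition eis_norm (x y : int) : int := x ^+ 2 - x * y + y ^+ 2.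

Definition eis (F : fieldType) (w : F) (x y : int) : F := x%:~R + y%:~R * w.

(** For [p = 2 mod 3] conjugation is the [p]-th power, and the negative sign gives [(z / z ^ p) ^ (-
    (p + 1) / 3) = z ^ ((p ^ 2 - 1) / 3)]. *)
Definition frob_exponent (p : nat) : int :=
  if (p %% 3 == 1)%N then ((p - 1) %/ 3)%N%:Z else - ((p + 1) %/ 3)%N%:Z.

(* For [p = N(pi) = 1 mod 3] this is the quotient of the cubic residue symbols
   of [x + y omega] and of its conjugate modulo [pi]; for [p = 2 mod 3] it is
   the cubic residue symbol of [x + y omega] modulo [p]. *)
Definition frob_symbol (F : fieldType) (w : F) (p : nat) (x y : int) : F :=
  (eis w x y / eis (w ^+ 2) x y) ^ frob_exponent p.

(* [S] is the discrete logarithm of the cubic residue symbol modulo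
   [x + y omega] on rational integers. *)
Definition cubic_reciprocity (x y : int) : Prop :=
  exists S : nat -> nat,
  let N := `|eis_norm x y|%N in
  [/\ forall m n, coprime N m -> coprime N n ->
        (S (m * n) = S m + S n %[mod 3])%N,
      forall m n, (m = n %[mod N] -> S m = S n %[mod 3])%N &
      forall (F : closedFieldType) (w : F) (p : nat), p \in [pchar F] ->
        w ^+ 2 + w + 1 = 0 -> coprime (3 * N) p ->
        frob_symbol w p x y = w ^+ S p].

(** * Eisenstein integers in coordinates *)

Section Eisenstein.

Variables (F : fieldType) (w : F).
Hypothesis wP : w ^+ 2 + w + 1 = 0.

Let w2 : w ^+ 2 = - w - 1 := omega_sqrE wP.

Lemma eisM x1 y1 x2 y2 :
  eis w (x1 * x2 - y1 * y2) (x1 * y2 + y1 * x2 - y1 * y2) =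
  eis w x1 y1 * eis w x2 y2.
Proof.
rewrite /eis !(rmorphB, rmorphD, rmorphM) /=; apply/eqP; rewrite -subr_eq0.
rewrite (_ : _ - _ = - y1%:~R * y2%:~R * (w ^+ 2 + w + 1)); last by ring.
by rewrite wP mulr0.
Qed.

Lemma eis_mul_conj x y : eis w x y * eis (w ^+ 2) x y = (eis_norm x y)%:~R.
Proof.
rewrite /eis /eis_norm !(rmorphB, rmorphD, rmorphM, rmorphXn) /= w2.
apply/eqP; rewrite -subr_eq0.
rewrite (_ : _ - _ = - y%:~R ^+ 2 * (w ^+ 2 + w + 1)); last by ring.
by rewrite wP mulr0.
Qed.

Lemma eis_conj x y : eis w (x - y) (- y) = eis (w ^+ 2) x y.
Proof. by rewrite /eis rmorphB rmorphN /= w2; ring. Qed.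

End Eisenstein.

Lemma eis_normM x1 y1 x2 y2 :
  eis_norm (x1 * x2 - y1 * y2) (x1 * y2 + y1 * x2 - y1 * y2) =
  eis_norm x1 y1 * eis_norm x2 y2.
Proof. by rewrite /eis_norm; ring. Qed.

Lemma eis_norm_conj x y : eis_norm (x - y) (- y) = eis_norm x y.
Proof. by rewrite /eis_norm; ring. Qed.

Lemma frob_symbolM (F : fieldType) (w : F) p x1 y1 x2 y2 :
  w ^+ 2 + w + 1 = 0 ->
  frob_symbol w p (x1 * x2 - y1 * y2) (x1 * y2 + y1 * x2 - y1 * y2) =
  frob_symbol w p x1 y1 * frob_symbol w p x2 y2.
Proof.
move=> wP; have w2P := omega_sqr wP.
by rewrite /frob_symbol !eisM // -mulf_div expfzMl.
Qed.

Lemma frob_symbol_conj (F : fieldType) (w : F) p x y : w ^+ 2 + w + 1 = 0 ->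
  frob_symbol w p (x - y) (- y) = (frob_symbol w p x y)^-1.
Proof.
move=> wP; have w2P := omega_sqr wP; have w3 := cube_root1 wP.
rewrite /frob_symbol !eis_conj // -exprM (exprS _ 3) w3 mulr1.
by rewrite invr_expz -exprz_inv invf_div.
Qed.

Lemma pchar_natr_eq0 (F : fieldType) p n :
  p \in [pchar F] -> (n%:R == 0 :> F) = (p %| n)%N.
Proof. by move=> pF; rewrite (dvdn_pcharf pF). Qed.

Lemma pchar_intr_eq0 (F : fieldType) p (n : int) :
  p \in [pchar F] -> (n%:~R == 0 :> F) = (p %| `|n|)%N.
Proof.
move=> pF; rewrite -(pchar_natr_eq0 _ pF) pmulrn.
by case: (intP n) => // k; rewrite ?abszN // rmorphN oppr_eq0.
Qed.

Lemma pchar_eis_neq0 (F : fieldType) (w : F) p x y : p \in [pchar F] ->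
  w ^+ 2 + w + 1 = 0 -> coprime `|eis_norm x y| p ->
  eis w x y != 0 /\ eis (w ^+ 2) x y != 0.
Proof.
move=> pF wP cop; have p_pr := pcharf_prime pF; apply/andP.
rewrite -negb_or -mulf_eq0 eis_mul_conj // (pchar_intr_eq0 _ pF).
by rewrite -prime_coprime // coprime_sym.
Qed.

Lemma cubic_reciprocity_rat x : cubic_reciprocity x 0.
Proof.
exists (fun=> 0%N); split=> // F w p pF wP; rewrite coprimeMl => /andP[_ cop].
have [] := pchar_eis_neq0 pF wP cop.
by rewrite /frob_symbol /eis !mul0r !addr0 => n1 _; rewrite divff // exp1rz.
Qed.

Lemma cubic_reciprocityM x1 y1 x2 y2 :
  cubic_reciprocity x1 y1 -> cubic_reciprocity x2 y2 ->
  cubic_reciprocity (x1 * x2 - y1 * y2) (x1 * y2 + y1 * x2 - y1 * y2).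
Proof.
move=> [S1 [M1 P1 L1]] [S2 [M2 P2 L2]]; exists (fun n => S1 n + S2 n)%N.
rewrite /= eis_normM abszM; split=> [m n|m n mn|F w p pF wP].
- rewrite !coprimeMl => /andP[m1 m2] /andP[n1 n2].
  by have := M1 m n m1 n1; have := M2 m n m2 n2; lia.
- have dvd_mod k l d e : (k %| l)%N -> (d = e %[mod l] -> d = e %[mod k])%N.
    by move=> kl de; rewrite -(modn_dvdm d kl) de modn_dvdm.
  have := P1 m n (dvd_mod _ _ _ _ (dvdn_mulr _ (dvdnn _)) mn).
  have := P2 m n (dvd_mod _ _ _ _ (dvdn_mull _ (dvdnn _)) mn).
  lia.
- rewrite !coprimeMl => /and3P[c3 c1 c2].
  by rewrite frob_symbolM // exprD L1 ?L2 // coprimeMl c3.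
Qed.

(** Conjugation inverts the symbol, which amounts to doubling [S] since [w ^ 3 = 1]. *)
Lemma cubic_reciprocity_conj x y :
  cubic_reciprocity x y -> cubic_reciprocity (x - y) (- y).
Proof.
move=> [S [M P L]]; exists (fun n => 2 * S n)%N; rewrite /= eis_norm_conj.
split=> [m n cm cn|m n mn|F w p pF wP cop].
- by have := M m n cm cn; lia.
- by have := P m n mn; lia.
- rewrite frob_symbol_conj // L //; have w3 := cube_root1 wP.
  rewrite mulnC exprM; apply: mulr1_eq.
  by rewrite -exprS exprAC w3 expr1n.
Qed.

(** The witness is the Jacobi sum [J] of a cubic character modulo [q], and [S] is the index of that
    character. Reciprocity comes from computing [g ^ p], for the Gauss sum [g], both by Frobenius
    and from [g ^ 3 = J ^ 2 J']. *)
Lemma cubic_reciprocity_prime (q : nat) : prime q -> (q %% 3 = 1)%N ->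
  exists l m : int,
    [/\ eis_norm l m = q%:Z, (3 %| m)%Z & cubic_reciprocity l m].
Proof.
move=> q_pr q1; have [ind indP] := cubic_index_exists q_pr q1.
pose l : int := #|jacobi_class ind 0|%:Z - #|jacobi_class ind 2|%:Z.
pose m : int := #|jacobi_class ind 1|%:Z - #|jacobi_class ind 2|%:Z.
have JE (F : fieldType) (w : F) : w ^+ 2 + w + 1 = 0 ->
    jacobi_sum (char_of_index ind w) = eis w l m.
  exact: jacobi_sum_classes.
have chi2E (F : fieldType) (w : F) :
    (fun x => char_of_index ind w x ^+ 2) =1 char_of_index ind (w ^+ 2).
  move=> x; rewrite /char_of_index; case: eqP => _; first by rewrite expr0n.
  by rewrite exprAC.
have J2E (F : fieldType) (w : F) : w ^+ 2 + w + 1 = 0 ->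
    jacobi_sum (fun x => char_of_index ind w x ^+ 2) = eis (w ^+ 2) l m.
  move=> wP; rewrite -JE; last exact: omega_sqr.
  by apply: eq_bigr => x _; rewrite !chi2E.
(* An identity between integers, so it can be checked in characteristic 0. *)
have lmq : eis_norm l m = q%:Z.
  have [w wP] := omega_exists algC; have [psi [psiD psi0 psi1]] :=
    additive_character_exists algC q_pr.
  have q0 : #|'F_q|%:R != 0 :> algC.
    by rewrite card_Fp // pnatr_eq0 -lt0n prime_gt0.
  have n3 : 3%:R != 0 :> algC by rewrite pnatr_eq0.
  have := jacobi_sum_norm psiD psi0 psi1 q0 (char_of_indexP indP n3 wP).
  rewrite JE // J2E // eis_mul_conj // card_Fp // pmulrn => /eqP.
  by rewrite (eqr_int algC) => /eqP.
exists l, m; split=> //.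
  by apply: rpredB; apply: (dvdn_card_jacobi_class indP).
have q_dvd (n : nat) : coprime q n -> n%:R != 0 :> 'F_q.
  by move=> cn; rewrite (pchar_natr_eq0 _ (pchar_Fp q_pr)) -prime_coprime.
exists (fun n => ind n%:R); rewrite /= lmq absz_nat; split=> [a b ca cb|a b ab|].
- by rewrite natrM; apply: indP.1; apply: q_dvd.
- by rewrite -[in LHS](Fp_nat_mod q_pr) ab Fp_nat_mod.
move=> F w p pF wP; rewrite coprimeMl => /andP[c3 cq].
have p_pr := pcharf_prime pF; have p_gt1 := prime_gt1 p_pr.
have w3 := cube_root1 wP; have n3 : 3%:R != 0 :> F.
  by rewrite (pchar_natr_eq0 _ pF) -prime_coprime // coprime_sym.
have q0 : q%:R != 0 :> F.
  by rewrite (pchar_natr_eq0 _ pF) -prime_coprime // coprime_sym.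
have pq0 := q_dvd _ cq.
have [psi [psiD psi0 psi1]] := additive_character_exists F q_pr.
pose chi := char_of_index ind w.
have chiP : cubic_character chi := char_of_indexP indP n3 wP.
have [chiM chi0 chi3 _] := chiP.
pose g := gauss_sum psi chi; pose g' := gauss_sum psi (fun x => chi x ^+ 2).
pose J := eis w l m; pose J' := eis (w ^+ 2) l m.
have psiX x n : psi x ^+ n = psi (n%:R * x).
  elim: n => [|n IHn]; first by rewrite mul0r psi0.
  by rewrite exprS IHn -psiD mulrS mulrDl mul1r.
have gg' : g * g' = q%:R.
  by rewrite /g /g' gauss_sum_mul_sqr // card_Fp.
have g3 : g ^+ 3 = J ^+ 2 * J'.
  rewrite /g gauss_sum_cube // card_Fp // JE // -/J pmulrn -lmq.
  by rewrite -(eis_mul_conj wP) -/J -/J'; ring.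
have JJ' : J * J' = q%:R by rewrite /J /J' eis_mul_conj // lmq.
have [J0 J'0] : J != 0 /\ J' != 0.
  by apply/andP; rewrite -negb_or -mulf_eq0 JJ'.
have JJ'n0 : J ^+ 2 * J' != 0 by rewrite mulf_neq0 ?expf_neq0.
have g0 : g != 0.
  by apply: contraNneq q0 => g0; rewrite -gg' g0 mul0r.
pose c := chi p%:R; have -> : w ^+ ind p%:R = c.
  by rewrite /c /chi /char_of_index (negPf pq0).
have c3' : c ^+ 3 = 1 by apply: chi3.
have JX : J ^+ p = eis (w ^+ p) l m.
  rewrite -(pFrobenius_autE pF) /J /eis rmorphD rmorphM !rmorph_int /=.
  by rewrite pFrobenius_autE.
have gX : g ^+ p = \sum_x chi x ^+ p * psi (p%:R * x).
  rewrite -(pFrobenius_autE pF) rmorph_sum; apply: eq_bigr => x _.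
  by rewrite rmorphM /= !pFrobenius_autE psiX.
have gauss_scale (f : 'F_q -> F) : {morph f : x y / x * y} ->
    f p%:R * \sum_x f x * psi (p%:R * x) = gauss_sum psi f.
  move=> fM; rewrite mulr_sumr /gauss_sum [RHS](reindex (fun x => p%:R * x)).
    by apply: eq_bigr => x _; rewrite fM mulrA.
  by exists (fun x => p%:R^-1 * x) => x _; rewrite ?mulKf ?mulVKf.
have p_mod3 : (p %% 3 = 1 \/ p %% 3 = 2)%N.
  by move: c3; rewrite prime_coprime //; clear; lia.
rewrite /frob_symbol /frob_exponent -/J -/J'; case: p_mod3 => pE; rewrite pE /=.
(* Here [J ^ (p - 1) = 1] and [c g ^ (p - 1) = 1]; as [(J / J') (J ^ 2 J') = J ^ 3], this gives
   [(J / J') ^ n = c]. *)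
- set n := ((p - 1) %/ 3)%N; have pn : p = (3 * n).+1.
    by rewrite /n; clear -pE p_gt1; lia.
  have J3n : J ^+ (3 * n) = 1.
    apply: (mulfI J0); rewrite -exprS -pn mulr1 JX (divn_eq p 3) pE.
    by rewrite exprD mulnC exprM w3 expr1n mul1r.
  have chip x : chi x ^+ p = chi x.
    have [->|x0] := eqVneq x 0; first by rewrite chi0 expr0n; case: (p) p_gt1.
    by rewrite pn exprS exprM chi3 // expr1n mulr1.
  have cg : c * g ^+ p = g.
    rewrite gX (eq_bigr _ (fun x _ => congr1 (fun t => t * _) (chip x))).
    exact: gauss_scale.
  have : c * (J ^+ 2 * J') ^+ n = 1.
    by rewrite -g3 -exprM; apply: (mulIf g0); rewrite mul1r -mulrA -exprSr -pn.
  rewrite -exprnP => cJ; apply: (mulIf (expf_neq0 n JJ'n0)).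
  rewrite cJ -exprMn (_ : J / J' * (J ^+ 2 * J') = J ^+ 3) -?exprM //.
  by field.
(* Frobenius now conjugates: [J ^ (p + 1) = J J' = q] and [g ^ (p + 1) = c q], whence
   [(J' / J) ^ n = c]. *)
- set n := ((p + 1) %/ 3)%N; have pn : p.+1 = (3 * n)%N.
    by rewrite /n; clear -pE; lia.
  have J3n : J ^+ (3 * n) = q%:R.
    rewrite -pn exprSr JX (divn_eq p 3) pE.
    by rewrite exprD mulnC exprM w3 expr1n mul1r mulrC JJ'.
  have chip x : chi x ^+ p = chi x ^+ 2.
    have [->|x0] := eqVneq x 0; first by rewrite chi0 !expr0n; case: (p) p_gt1.
    by rewrite (divn_eq p 3) pE exprD mulnC exprM chi3 // expr1n mul1r.
  have cg : c ^+ 2 * g ^+ p = g'.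
    rewrite gX (eq_bigr _ (fun x _ => congr1 (fun t => t * _) (chip x))).
    by rewrite (gauss_scale (fun x => chi x ^+ 2)) // => x y; rewrite chiM exprMn.
  have cJ : (J ^+ 2 * J') ^+ n = c * q%:R.
    rewrite -g3 -exprM -pn exprS -gg' -cg; move: (g ^+ p) => gp.
    by rewrite -[LHS]mul1r -c3'; ring.
  rewrite -exprnN -exprVn invf_div; apply: (mulfI q0).
  rewrite [RHS]mulrC -cJ -J3n exprM -exprMn; congr (_ ^+ _).
  by field.
Qed.

(** * Factorization of primary Eisenstein integers *)

Lemma eis_norm_inert (q : nat) (x y : int) : prime q -> (q %% 3 = 2)%N ->
  (q%:Z %| eis_norm x y)%Z -> (q%:Z %| x)%Z /\ (q%:Z %| y)%Z.
Proof.
move=> q_pr q2; have qF := pchar_Fp q_pr.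
have dvdE (z : int) : (q%:Z %| z)%Z = (z%:~R == 0 :> 'F_q).
  by rewrite (pchar_intr_eq0 _ qF) dvdzE.
rewrite !dvdE /eis_norm rmorphD rmorphB !rmorphXn rmorphM /=.
move: (x%:~R) (y%:~R) => a b {x y} /eqP ab0.
(* [2 q - 1] is 3 times an odd number, so cubing is inverted by an odd power: [a ^ 3 = - b ^ 3]
   forces [a = - b], and then [3 b ^ 2 = 0]. *)
have fermat (c : 'F_q) : c = (c ^+ 3) ^+ (q %/ 3).*2.+1.
  have cq : c ^+ q = c by have := expf_card c; rewrite card_Fp.
  have E : (q + q = (3 * (q %/ 3).*2.+1).+1)%N by lia.
  have [->|c0] := eqVneq c 0; first by rewrite -exprM expr0n.
  by apply: (mulfI c0); rewrite -exprM -exprS -E exprD cq.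
have ab3 : a ^+ 3 = - b ^+ 3.
  apply/eqP; rewrite -addr_eq0; apply/eqP.
  transitivity ((a + b) * (a ^+ 2 - a * b + b ^+ 2)); first by ring.
  by rewrite ab0 mulr0.
have abN : a = - b.
  rewrite (fermat a) ab3 [in RHS](fermat b) exprNn -signr_odd /=.
  by rewrite odd_double /= expr1 mulN1r.
have b0 : b == 0.
  have /eqP : 3%:R * b ^+ 2 = 0 by rewrite -ab0 abN; ring.
  rewrite mulf_eq0 expf_eq0 (pchar_natr_eq0 _ qF) /= => /orP[q3|//].
  by exfalso; move: q3 q2; rewrite dvdn_prime2 // => /eqP ->.
by rewrite b0 abN oppr_eq0.
Qed.

Lemma eis_norm_dvd3 x y : (3 %| y)%Z -> (3 %| eis_norm x y)%Z = (3 %| x)%Z.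
Proof.
move=> /dvdzP[z ->].
rewrite /eis_norm (_ : _ + _ = x ^+ 2 + (z ^+ 2 * 3 - x * z) * 3); last by ring.
rewrite rpredDr; last exact: dvdz_mull.
by rewrite !dvdzE abszX Euclid_dvdX ?andbT.
Qed.

(** Exact division by [l + m omega]: multiplying [x + y omega] by the conjugate of [l + m omega]
    gives [q] times the quotient, with [omega]-coordinate [y l - x m]. *)
Lemma cubic_reciprocity_divide (q : nat) (x y l m : int) :
  prime q -> (q %% 3 != 0)%N -> eis_norm l m = q%:Z -> (3 %| y)%Z -> (3 %| m)%Z ->
  (q%:Z %| eis_norm x y)%Z -> (q%:Z %| y * l - x * m)%Z ->
  cubic_reciprocity l m -> exists x' y' : int,
    [/\ (3 %| y')%Z, eis_norm x y = eis_norm x' y' * q%:Z &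
        cubic_reciprocity x' y' -> cubic_reciprocity x y].
Proof.
move=> q_pr q_n3 lmq y3 m3 qN /dvdzP[I IE] lmP.
have q0 : q%:Z != 0 by rewrite eqz_nat -lt0n prime_gt0.
(* The other coordinate [R] of that product. The norm [R ^ 2 - R I + I ^ 2] is divisible by [q],
   where [I = y l - x m] is too, so [q] divides [R]. *)
have /dvdzP[R RE] : (q%:Z %| x * (l - m) + y * m)%Z.
  suff : (q%:Z %| (x * (l - m) + y * m) ^+ 2)%Z.
    by rewrite !dvdzE abszX Euclid_dvdX ?andbT.
  set R := x * _ + _.
  have -> : R ^+ 2 = eis_norm x y * eis_norm l m
      + (y * l - x * m) * (R - (y * l - x * m)).
    by rewrite /eis_norm /R; ring.
  by apply: rpredD; [apply: dvdz_mulr | apply: dvdz_mulr; rewrite IE dvdz_mull].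
have I3 : (3 %| I)%Z.
  have : (3 %| I * q%:Z)%Z.
    by rewrite -IE; apply: rpredB; [apply: dvdz_mulr | apply: dvdz_mull].
  by rewrite !dvdzE abszM Euclid_dvdM // /dvdn (negPf q_n3) orbF.
exists R, I; split=> //.
  apply: (mulIf q0); rewrite -lmq -mulrA -expr2.
  transitivity (eis_norm (R * q%:Z) (I * q%:Z)); last first.
    by rewrite -lmq /eis_norm; ring.
  by rewrite -RE -IE /eis_norm; ring.
move=> RI; have := cubic_reciprocityM RI lmP.
congr cubic_reciprocity; apply: (mulIf q0).
  transitivity ((R * q%:Z) * l - (I * q%:Z) * m); first by ring.
  by rewrite -RE -IE -lmq /eis_norm; ring.
transitivity ((R * q%:Z) * m + (I * q%:Z) * l - (I * q%:Z) * m); first by ring.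
by rewrite -RE -IE -lmq /eis_norm; ring.
Qed.

(** Induction on the norm. A prime factor [q = 2 mod 3] of it divides both coordinates; for
    [q = 1 mod 3] a Jacobi sum or its conjugate is split off. The conditions modulo 3 pass to the
    quotient. *)
Theorem cubic_reciprocity_primary (x y : int) :
  (3 %| y)%Z -> ~~ (3 %| x)%Z -> cubic_reciprocity x y.
Proof.
move=> y3; rewrite -(eis_norm_dvd3 x y3); have [n] := ubnP `|eis_norm x y|%N.
elim: n => // n IHn in x y y3 *; rewrite ltnS => leN N3.
have [->|y0] := eqVneq y 0; first exact: cubic_reciprocity_rat.
have N_gt1 : (1 < `|eis_norm x y|)%N.
  have E : 4 * eis_norm x y = (2 * x - y) ^+ 2 + 3 * y ^+ 2.
    by rewrite /eis_norm; ring.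
  have := sqr_ge0 (2 * x - y); have : 9 <= y ^+ 2.
    by case/dvdzP: y3 y0 => z ->; clear; nia.
  by clear -E; move: (y ^+ 2) (_ ^+ 2) E => a b; lia.
set q := pdiv `|eis_norm x y|; have q_pr : prime q := pdiv_prime N_gt1.
have q_gt1 := prime_gt1 q_pr; have qN : (q%:Z %| eis_norm x y)%Z := pdiv_dvd _.
have q_n3 : (q %% 3 != 0)%N.
  rewrite -/(dvdn 3 q) dvdn_prime2 //; apply: contra N3 => /eqP q3.
  by move: qN; rewrite -q3.
have descend x' y' k : (1 < k)%N -> eis_norm x y = eis_norm x' y' * k%:Z ->
    (3 %| y')%Z -> cubic_reciprocity x' y'.
  move=> k_gt1 E y'3; apply: IHn => //.
    apply: leq_trans leN; move: (ltnW N_gt1); rewrite E abszM muln_gt0.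
    by case/andP=> N'0 _; rewrite ltn_Pmulr.
  by apply: contra N3; rewrite E => N3; apply: dvdz_mulr.
have [q2|q1] : (q %% 3 = 2 \/ q %% 3 = 1)%N by clear -q_n3; lia.
  have [/dvdzP[x' xE] /dvdzP[y' yE]] := eis_norm_inert q_pr q2 qN.
  have y'3 : (3 %| y')%Z.
    by move: y3; rewrite yE !dvdzE abszM Euclid_dvdM // /dvdn (negPf q_n3) orbF.
  have xy'P := descend x' y' (q * q)%N _ _ y'3.
  have := cubic_reciprocityM (xy'P _ _) (cubic_reciprocity_rat q%:Z).
  rewrite !mulr0 subr0 add0r subr0 -xE -yE; apply.
    by rewrite (ltn_mul q_gt1 q_gt1).
  by rewrite xE yE /eis_norm PoszM; ring.
have [l [m [lmq m3 lmP]]] := cubic_reciprocity_prime q_pr q1.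
suff [x' [y' [y'3 E xyP]]] : exists x' y' : int,
    [/\ (3 %| y')%Z, eis_norm x y = eis_norm x' y' * q%:Z &
        cubic_reciprocity x' y' -> cubic_reciprocity x y].
  by apply/xyP/(descend _ _ _ q_gt1 E).
(* The factor divisible by [q] decides whether [l + m omega] or its conjugate divides
   [x + y omega]. *)
have : (q%:Z %| (y * l - x * m) * (y * (l - m) - x * (- m)))%Z.
  rewrite (_ : _ * _ = y ^+ 2 * eis_norm l m - m ^+ 2 * eis_norm x y).
    by rewrite lmq; apply: rpredB; [apply: dvdz_mull | apply: dvdz_mull].
  by rewrite /eis_norm; ring.
rewrite dvdzE abszM Euclid_dvdM // => /orP[] qI.
  exact: (cubic_reciprocity_divide q_pr q_n3 lmq y3 m3 qN qI lmP).
apply: (cubic_reciprocity_divide q_pr q_n3 _ y3 _ qN qI).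
- by rewrite eis_norm_conj.
- by rewrite rpredN.
- exact: cubic_reciprocity_conj.
Qed.

(** * The parity of c in c^2 + 11 d^2 = 4 k p *)

Lemma completely_additive_eq0 (N : nat) (S : nat -> nat) (n : nat) :
  (forall a b, coprime N a -> coprime N b ->
     (S (a * b) = S a + S b %[mod 3])%N) ->
  (0 < n)%N -> coprime N n ->
  (forall r, prime r -> (r %| n)%N -> (3 %| S r)%N) -> (3 %| S n)%N.
Proof.
move=> SM; elim/ltn_ind: n => n IHn n_gt0 cop Sr.
have [n1|n_gt1] := leqP n 1.
  have -> : n = 1%N by lia.
  by have := SM 1%N 1%N (coprimen1 N) (coprimen1 N); rewrite muln1; lia.
have r_pr := pdiv_prime n_gt1; have r_dvd := pdiv_dvd n.
have E := divnK r_dvd; have m_gt0 : (0 < n %/ pdiv n)%N.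
  by rewrite divn_gt0 ?prime_gt0 // dvdn_leq.
move: cop; rewrite -E coprimeMr => /andP[cm cr].
have Sm : (3 %| S (n %/ pdiv n))%N.
  apply: IHn => // [|r r_pr' rm]; first by rewrite ltn_Pdiv ?prime_gt1.
  by apply: Sr r_pr' _; rewrite -E dvdn_mulr.
move: (SM _ _ cm cr) Sm (Sr _ r_pr r_dvd).
by move: (S _) (S _) (S _) => a b c'; lia.
Qed.

(** The difference of the squares is [(A - B) (A + B)], where [A - B = 3 c (w - w ^ 2)] and
    [A + B = 2 e - 3 c = 13 d]. So [A / B] is a sign at the primes dividing [c d], when [B] is
    nonzero there. *)
Lemma eis_sqr_eq (F : fieldType) (w : F) (r : nat) (c d e : int) :
  r \in [pchar F] -> w ^+ 2 + w + 1 = 0 -> 13 * d + 3 * c = 2 * e ->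
  (r%:Z %| c * d)%Z ->
  eis w e (3 * c) ^+ 2 = eis (w ^+ 2) e (3 * c) ^+ 2.
Proof.
move=> rF wP de; rewrite dvdzE -(pchar_intr_eq0 _ rF) rmorphM => /eqP cd0.
apply/eqP; rewrite -subr_eq0 subr_sqr /eis; apply/eqP.
have -> : e%:~R + (3 * c)%:~R * w + (e%:~R + (3 * c)%:~R * w ^+ 2)
    = 13%:R * d%:~R + (3 * c)%:~R * (w ^+ 2 + w + 1).
  transitivity ((2 * e)%:~R + (3 * c)%:~R * (w ^+ 2 + w) : F).
    by rewrite rmorphM /=; ring.
  by rewrite -de rmorphD !rmorphM /=; ring.
rewrite wP mulr0 addr0 rmorphM /=.
transitivity (39%:R * (c%:~R * d%:~R) * (w - w ^+ 2)); first by ring.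
by rewrite cd0 mulr0 mul0r.
Qed.

Lemma prime_dvdzM (r : nat) (a b : int) : prime r ->
  (r%:Z %| a * b)%Z = (r%:Z %| a)%Z || (r%:Z %| b)%Z.
Proof. by move=> r_pr; rewrite !dvdzE abszM Euclid_dvdM. Qed.

Section FrobeniusParity.

Variables (p k : nat) (c d e : int).
Hypothesis p_pr : prime p.
Hypothesis p_coprime : ~~ (p %| 2 * 3 * 11)%N.
Hypothesis k_cases : k = 1%N \/ k = 11%N.
Hypothesis c_dvd : (k%:Z %| c)%Z.
Hypothesis cdk : c ^+ 2 + 11 * d ^+ 2 = 4 * (k * p)%N%:Z.
Hypothesis de : 13 * d + 3 * c = 2 * e.
Hypothesis d_n3 : ~~ (3 %| d)%Z.

Lemma p_neq_2_3_11 : [/\ p != 2, p != 3 & p != 11]%N.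
Proof.
by split; apply: contra p_coprime => /eqP ->.
Qed.

(** Such an [r] would also divide [c], so [r ^ 2] would divide [4 k p]; this fails for [r = p] and
    for [r = k = 11]. *)
Lemma no_common_prime_divisor (r : nat) :
  prime r -> (r%:Z %| d)%Z -> (r %| k * p)%N -> False.
Proof.
move=> r_pr rd rkp; have [p2 p3 p11] := p_neq_2_3_11.
have rc : (r%:Z %| c)%Z.
  have : (r%:Z %| c * c)%Z.
    rewrite (_ : c * c = 4 * (k * p)%N%:Z - 11 * d * d).
      by apply: rpredB; apply: dvdz_mull.
    by rewrite -cdk; ring.
  by rewrite prime_dvdzM // orbb.
have : (r%:Z * r%:Z %| 4 * (k * p)%N%:Z)%Z.
  rewrite -cdk !expr2; apply: rpredD; first exact: dvdz_mul.
  by apply: dvdz_mull; apply: dvdz_mul.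
rewrite dvdzE !abszM (_ : `|(4 : int)%R| = 2 * 2)%N // !absz_nat.
have r0 := prime_gt0 r_pr.
move: rkp; rewrite Euclid_dvdM // => /orP[rk|].
  case: k_cases rk c_dvd => -> //.
    by rewrite dvdn1 => /eqP r1; rewrite r1 in r_pr.
  rewrite dvdn_prime2 // => /eqP -> _.
  rewrite mulnCA dvdn_pmul2l // !Euclid_dvdM // !dvdn_prime2 //= eq_sym.
  by rewrite (negPf p11).
rewrite dvdn_prime2 // => /eqP ->; rewrite mulnA dvdn_pmul2r ?prime_gt0 //.
by case: k_cases => ->; rewrite ?muln1 !Euclid_dvdM // !dvdn_prime2 //
  (negPf p2) /= ?(negPf p11).
Qed.

(** [e + 3 c omega] is [epsilon = (13 d + 3 c sqrt (-3)) / 2], of norm [(169 d ^ 2 + 27 c ^ 2) / 4];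
    substitute [c ^ 2 = 4 k p - 11 d ^ 2]. *)
Lemma eis_norm_cdk :
  eis_norm e (3 * c) = 27 * (k * p)%N%:Z - 32 * d ^+ 2 /\
  0 <= eis_norm e (3 * c).
Proof.
have E : 4 * eis_norm e (3 * c) = 169 * d ^+ 2 + 27 * c ^+ 2.
  transitivity ((2 * e) ^+ 2 - 6 * c * (2 * e) + 36 * c ^+ 2).
    by rewrite /eis_norm; ring.
  by rewrite -de; ring.
have := sqr_ge0 c; have := sqr_ge0 d; clear -cdk E.
by move: (c ^+ 2) (d ^+ 2) cdk E => C D; lia.
Qed.

(** A prime dividing the norm and one of [27 k p], [32 d ^ 2] divides both. It is not 3 because of
    [d], nor 2 because [k p] is odd, so it divides both [d] and [k p]. *)
Lemma coprime_eis_norm (r : nat) : prime r ->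
  (r%:Z %| 3 * (k * p)%N%:Z)%Z || (r%:Z %| 2 * d)%Z ->
  coprime `|eis_norm e (3 * c)| r.
Proof.
move=> r_pr rkpd; rewrite coprime_sym prime_coprime //; apply/negP => rN.
have [NE _] := eis_norm_cdk; have [p2 p3 p11] := p_neq_2_3_11.
have {}rN : (r%:Z %| 27 * (k * p)%N%:Z - 32 * d ^+ 2)%Z by rewrite -NE.
have r1 : (r%:Z %| 27 * (k * p)%N%:Z)%Z.
  case/orP: rkpd => h.
    by rewrite (_ : 27 * _ = 9 * (3 * (k * p)%N%:Z)); [apply: dvdz_mull | ring].
  suff d2 : (r%:Z %| 32 * d ^+ 2)%Z by move: rN; rewrite (rpredBr _ d2).
  by rewrite (_ : 32 * _ = 16 * d * (2 * d)); [apply: dvdz_mull | ring].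
have r2 : (r%:Z %| 32 * d ^+ 2)%Z by move: rN; rewrite (rpredBl _ r1).
have r_n3 : r != 3%N.
  apply: contra d_n3 => /eqP r3; move: r2; rewrite r3 prime_dvdzM // expr2.
  by rewrite prime_dvdzM // orbb.
have r_n2 : r != 2%N.
  have p_odd : odd p by case: (even_prime p_pr) p2 => // ->.
  apply/eqP => r2'; move: r1; rewrite r2' prime_dvdzM // !dvdzE absz_nat.
  by rewrite !dvdn2 oddM p_odd andbT; case: k_cases => ->.
have rd : (r%:Z %| d)%Z.
  move: r2; rewrite (_ : 32 = 2 ^+ 5) // !dvdzE abszM !abszX Euclid_dvdM //.
  by rewrite !Euclid_dvdX // !andbT dvdn_prime2 // (negPf r_n2).
apply: (no_common_prime_divisor r_pr rd).
have r3 : (r%:Z %| 3)%Z = false by rewrite dvdzE dvdn_prime2 // (negPf r_n3).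
move: r1; rewrite (_ : 27 * _ = 3 * (3 * (3 * (k * p)%N%:Z))); last by ring.
by rewrite !prime_dvdzM // r3.
Qed.

(** Modulo the norm, [27 k p = 32 d ^ 2]. As [S] vanishes modulo 3 on [k], [d] and the cube 27, this
    reads [S p = 5 S 2], and [S 2] vanishes exactly when [c] is even. *)
Theorem frob_symbol_eq1 (F : closedFieldType) (w : F) : p \in [pchar F] ->
  w ^+ 2 + w + 1 = 0 -> (frob_symbol w p e (3 * c) == 1) = (2 %| c)%Z.
Proof.
move=> pF wP; have [p2 p3 p11] := p_neq_2_3_11.
have [NE N_ge0] := eis_norm_cdk.
have e_n3 : ~~ (3 %| e)%Z.
  apply: contra d_n3 => e3; have : (3 %| 13 * d)%Z.
    rewrite (_ : 13 * d = 2 * e - 3 * c); last by rewrite -de; ring.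
    by apply: rpredB; [apply: dvdz_mull | apply: dvdz_mulr].
  by rewrite prime_dvdzM.
have [S [SM SN SF]] := cubic_reciprocity_primary (dvdz_mulr c (dvdzz 3)) e_n3.
set N := `|eis_norm e (3 * c)|%N in SM SN SF.
(* The symbol at [r] is a cube root of unity whose square is 1 by [eis_sqr_eq]. *)
have S0 (r : nat) : prime r -> (r%:Z %| c * d)%Z -> coprime N r ->
    r != 3%N -> (3 %| S r)%N.
  move=> r_pr rcd cNr r3; have [F' rF'] := closed_field_pchar r_pr.
  have [w' w'P] := omega_exists F'.
  have n3 : 3%:R != 0 :> F' by rewrite (pchar_natr_eq0 _ rF') dvdn_prime2.
  have w'3 := prim3_root (cube_root1 w'P) (omega_neq1 n3 w'P).
  have cop : coprime (3 * N) r.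
    by rewrite coprimeMl cNr coprime_sym prime_coprime // dvdn_prime2 // r3.
  have TS := SF _ _ _ rF' w'P cop.
  have : frob_symbol w' r e (3 * c) ^+ 2 = 1.
    have [_ B0] := pchar_eis_neq0 rF' w'P cNr.
    have sqrz (x : F') (n : int) : (x ^ n) ^+ 2 = (x ^+ 2) ^ n.
      by rewrite !exprnP !exprz_exp mulrC.
    rewrite /frob_symbol sqrz expr_div_n.
    by rewrite (eis_sqr_eq rF' w'P de rcd) divff ?expf_neq0 // exp1rz.
  rewrite TS -exprM => /eqP; rewrite -(prim_order_dvd w'3).
  by rewrite Gauss_dvdl.
have copN (r : nat) : prime r ->
    (r%:Z %| 3 * (k * p)%N%:Z)%Z || (r%:Z %| 2 * d)%Z -> coprime N r.
  exact: coprime_eis_norm.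
have p_cop : coprime N p.
  by apply: copN => //; apply/orP; left; apply/dvdz_mull/dvdn_mull.
have two_cop : coprime N 2.
  by apply: copN => //; apply/orP; right; apply: dvdz_mulr.
have three_cop : coprime N 3.
  by apply: copN => //; apply/orP; left; apply: dvdz_mulr.
have k_cop : coprime N k.
  case: k_cases => kE; first by rewrite kE coprimen1.
  rewrite kE; apply: copN => //; rewrite kE; apply/orP; left.
  by apply/dvdz_mull/dvdn_mulr.
have d_cop (r : nat) : prime r -> (r %| `|d|)%N -> coprime N r.
  by move=> r_pr rd; apply: copN => //; apply/orP; right; apply: dvdz_mull.
have d0 : (0 < `|d|)%N.
  by rewrite absz_gt0; apply: contraNneq d_n3 => ->; apply: dvdz0.
have dN : coprime N `|d|.
  apply: contraT; rewrite /coprime => g1.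
  have g_gt1 : (1 < gcdn N `|d|)%N.
    by rewrite ltn_neqAle eq_sym g1 gcdn_gt0 d0 orbT.
  have /d_cop := dvdn_trans (pdiv_dvd _) (dvdn_gcdr N `|d|).
  move/(_ (pdiv_prime g_gt1)); rewrite coprime_sym prime_coprime ?pdiv_prime //.
  by rewrite (dvdn_trans (pdiv_dvd _) (dvdn_gcdl N `|d|)).
have Sd : (3 %| S `|d|%N)%N.
  apply: (completely_additive_eq0 SM) => // r r_pr rd.
  apply: S0 => //; [exact: dvdz_mull | exact: d_cop |].
  by apply: contra d_n3 => /eqP r3; move: rd; rewrite r3.
have S1 : (3 %| S 1)%N.
  have := SM 1%N 1%N (coprimen1 N) (coprimen1 N); rewrite muln1.
  by clear; move: (S 1%N) => a; lia.
have Sk : (3 %| S k)%N.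
  case: k_cases => kE; first by rewrite kE.
  by apply: S0 => //; [rewrite kE | apply: dvdz_mulr | rewrite kE].
have S2 : (3 %| S 2)%N = (2 %| c)%Z.
  apply/idP/idP => [S23|c2]; last first.
    by apply: S0 => //; apply: dvdz_mulr.
  have [F' F'2] := closed_field_pchar (isT : prime 2).
  have [w' w'P] := omega_exists F'; have w'3 := cube_root1 w'P.
  have n3 : 3%:R != 0 :> F' by rewrite (pchar_natr_eq0 _ F'2).
  have w'1 := omega_neq1 n3 w'P.
  have := SF _ _ _ F'2 w'P; rewrite coprimeMl two_cop => /(_ isT).
  rewrite -(expr_mod _ w'3) (eqP S23) expr0.
  have [_ B0] := pchar_eis_neq0 F'2 w'P two_cop.
  (* At 2 the symbol is the inverse of [A / B]; it is 1 only if [3 c (w - w ^ 2)] vanishes in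
     characteristic 2. *)
  rewrite /frob_symbol (_ : frob_exponent 2 = - 1) //.
  rewrite exprN1 => /(congr1 GRing.inv); rewrite invrK invr1 => /divr1_eq /eqP.
  rewrite /eis -subr_eq0 opprD addrACA subrr add0r -mulrBr mulf_eq0.
  have w0 : w' != 0.
    by apply: contra_eq_neq w'3 => ->; rewrite expr0n eq_sym oner_eq0.
  rewrite -[X in X - _]mulr1 expr2 -mulrBr mulf_eq0 (negPf w0) /=.
  rewrite subr_eq0 [1 == _]eq_sym (negPf w'1) orbF (pchar_intr_eq0 _ F'2).
  by rewrite abszM Euclid_dvdM.
have NN : (3 * (3 * (3 * (k * p))) =
    N + 2 * (2 * (2 * (2 * (2 * (`|d| * `|d|))))))%N.
  have NZ : N%:Z = eis_norm e (3 * c) by rewrite /N gez0_abs.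
  have dd : (`|d| * `|d|)%N%:Z = d ^+ 2 
    by rewrite PoszM abszE -normrM -expr2 ger0_norm ?sqr_ge0.
  by clear -NZ dd NE; lia.
have E : S p = 5 * S 2 %[mod 3].
  have := SN (3 * (3 * (3 * (k * p))))%N
    (2 * (2 * (2 * (2 * (2 * (`|d| * `|d|))))))%N.
  rewrite {1}NN modnDl => /(_ erefl).
  have a1 := SM _ _ k_cop p_cop.
  have c1 : coprime N (k * p) by rewrite coprimeMr k_cop.
  have a2 := SM _ _ three_cop c1.
  have c2 : coprime N (3 * (k * p)) by rewrite coprimeMr three_cop.
  have a3 := SM _ _ three_cop c2.
  have c3 : coprime N (3 * (3 * (k * p))) by rewrite coprimeMr three_cop.
  have a4 := SM _ _ three_cop c3.
  have b1 := SM _ _ dN dN.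
  have e1 : coprime N (`|d| * `|d|) by rewrite coprimeMr dN.
  have b2 := SM _ _ two_cop e1.
  have e2 : coprime N (2 * (`|d| * `|d|)) by rewrite coprimeMr two_cop.
  have b3 := SM _ _ two_cop e2.
  have e3 : coprime N (2 * (2 * (`|d| * `|d|))) by rewrite coprimeMr two_cop.
  have b4 := SM _ _ two_cop e3.
  have e4 : coprime N (2 * (2 * (2 * (`|d| * `|d|)))).
    by rewrite coprimeMr two_cop.
  have b5 := SM _ _ two_cop e4.
  have e5 : coprime N (2 * (2 * (2 * (2 * (`|d| * `|d|))))).
    by rewrite coprimeMr two_cop.
  have b6 := SM _ _ two_cop e5.
  move: Sd Sk a1 a2 a3 a4 b1 b2 b3 b4 b5 b6; clear.
  by do 15! (move: (S _) => ?); lia.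
have n3 : 3%:R != 0 :> F by rewrite (pchar_natr_eq0 _ pF) dvdn_prime2.
have w3 := cube_root1 wP; have w_prim := prim3_root w3 (omega_neq1 n3 wP).
rewrite (SF _ _ _ pF wP); last first.
  by rewrite coprimeMl p_cop coprime_sym prime_coprime // dvdn_prime2 // p3.
rewrite -(prim_order_dvd w_prim) -S2; move: E; clear.
by move: (S p) (S 2) => a b; lia.
Qed.

End FrobeniusParity.

(** * Frobenius on the roots of the characteristic polynomial *)

(** Coordinates of a power modulo the characteristic polynomial; the constant one involves the
    preceding index, hence the exponent [n.+1]. *)
Lemma berstel_expr (R : comPzRingType) (a : R) (n : nat) :
  a ^+ 3 = 2%:R * a ^+ 2 - 4%:R * a + 4%:R ->
  a ^+ n.+1 = (berstel n.+1)%:~R * a ^+ 2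
    + (berstel n.+2 - 2 * berstel n.+1)%:~R * a + (4 * berstel n)%:~R.
Proof.
move=> a3; elim: n => [|n IHn].
  by rewrite berstel0 berstel1 berstel2 mulr0 subr0 mul0r addr0 add0r mul1r.
rewrite exprSr IHn berstelSSS.
transitivity ((berstel n.+1)%:~R * a ^+ 3
  + (berstel n.+2 - 2 * berstel n.+1)%:~R * a ^+ 2
  + (4 * berstel n)%:~R * a); first by ring.
by rewrite a3 !(rmorphB, rmorphD, rmorphM) /=; ring.
Qed.

(** Fourier inversion over the cube roots of unity: the values of [x a + x ^ 2 b] at [1, w, w ^ 2]
    determine [3 a] and [3 b], and [k] cancels since [1 + w + w ^ 2 = 0]. *)
Lemma omega_coef_inj (F : fieldType) (w a b a' b' k : F) :
  3%:R != 0 :> F -> w ^+ 2 + w + 1 = 0 ->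
  a + b = a' + b' + k -> w * a + w ^+ 2 * b = w * a' + w ^+ 2 * b' + k ->
  w ^+ 2 * a + w * b = w ^+ 2 * a' + w * b' + k -> a = a' /\ b = b'.
Proof.
move=> n3 wP /eqP; rewrite -subr_eq0 => /eqP E0.
move=> /eqP; rewrite -subr_eq0 => /eqP E1.
move=> /eqP; rewrite -subr_eq0 => /eqP E2.
split; apply: (mulfI n3); apply/eqP; rewrite -subr_eq0; apply/eqP.
  transitivity ((a + b - (a' + b' + k))
    + w ^+ 2 * (w * a + w ^+ 2 * b - (w * a' + w ^+ 2 * b' + k))
    + w * (w ^+ 2 * a + w * b - (w ^+ 2 * a' + w * b' + k))
    - (w ^+ 2 + w + 1) * (2%:R * (w - 1) * (a - a')
                          + (1 + w * (w - 1)) * (b - b') - k)); first by ring.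
  by rewrite E0 E1 E2 wP !(mulr0, mul0r, addr0, subr0).
transitivity ((a + b - (a' + b' + k))
  + w * (w * a + w ^+ 2 * b - (w * a' + w ^+ 2 * b' + k))
  + w ^+ 2 * (w ^+ 2 * a + w * b - (w ^+ 2 * a' + w * b' + k))
  - (w ^+ 2 + w + 1) * (2%:R * (w - 1) * (b - b')
                        + (1 + w * (w - 1)) * (a - a') - k)); first by ring.
by rewrite E0 E1 E2 wP !(mulr0, mul0r, addr0, subr0).
Qed.

Section Cardano.

Variables (p : nat) (F : fieldType) (w u v : F).
Hypothesis pF : p \in [pchar F].
Hypothesis p_coprime : ~~ (p %| 2 * 3 * 11 * 13)%N.
Hypothesis wP : w ^+ 2 + w + 1 = 0.
Hypothesis uv : u * v = - 8%:R.
Hypothesis u3v3 : u ^+ 3 + v ^+ 3 = 52%:R.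

Let n3 : 3%:R != 0 :> F.
Proof.
rewrite (pchar_natr_eq0 _ pF); apply: contra p_coprime => p3.
by rewrite (_ : 2 * 3 * 11 * 13 = 286 * 3)%N // dvdn_mull.
Qed.

(** [104 = 2 * 52 = 8 * 13]: this rules out [C = -1] in the relation [52 = C ^ 3 * 52] below, and is
    where 13 must be excluded. *)
Let n104 : 104%:R != 0 :> F.
Proof.
rewrite (pchar_natr_eq0 _ pF) (_ : 104 = 2 * 2 * 2 * 13)%N //.
apply: contra p_coprime; rewrite !Euclid_dvdM ?(pcharf_prime pF) //.
by case: (p %| 2)%N => //= ->; rewrite orbT.
Qed.

Let w3 : w ^+ 3 = 1 := cube_root1 wP.

Lemma frob_natr n : n%:R ^+ p = n%:R :> F.
Proof. by rewrite -(pFrobenius_autE pF) rmorph_nat. Qed.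

Lemma frob_intr (n : int) : n%:~R ^+ p = n%:~R :> F.
Proof. by rewrite -(pFrobenius_autE pF) rmorph_int. Qed.

Lemma frobD (x y : F) : (x + y) ^+ p = x ^+ p + y ^+ p.
Proof. by rewrite -!(pFrobenius_autE pF) rmorphD. Qed.

Lemma frobN (x : F) : (- x) ^+ p = - x ^+ p.
Proof. by rewrite -!(pFrobenius_autE pF) rmorphN. Qed.

(* Cardano: for [x ^ 3 = 1] this runs through the roots of the characteristic
   polynomial of the Berstel recurrence. *)
Definition cardano_root (x : F) : F := (x * u + x ^+ 2 * v + 2%:R) / 3%:R.

Lemma cardano_rootP x : x ^+ 3 = 1 ->
  cardano_root x ^+ 3 =
  2%:R * cardano_root x ^+ 2 - 4%:R * cardano_root x + 4%:R.
Proof.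
move=> x3; apply/eqP; rewrite -subr_eq0; apply/eqP.
pose y := x * u + x ^+ 2 * v.
have y3 : y ^+ 3 = 52%:R - 24%:R * y.
  transitivity (x ^+ 3 * u ^+ 3 + (x ^+ 3) ^+ 2 * v ^+ 3
                + 3%:R * x ^+ 3 * (u * v) * y); first by rewrite /y; ring.
  by rewrite x3 expr1n !mul1r uv u3v3; ring.
rewrite /cardano_root -/y.
transitivity ((y ^+ 3 - (52%:R - 24%:R * y)) / 27%:R); last first.
  by rewrite y3 subrr mul0r.
have n27 : 27%:R != 0 :> F by rewrite (natrX _ 3 3) expf_neq0.
by field; rewrite n3 n27.
Qed.

(** In both cases the [p]-th power fixes each [x u + x ^ 2 v] with [x ^ 3 = 1], hence each root; in
    the second it exchanges the two terms. *)
Definition frob_trivial : Prop :=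
  w ^+ p = w /\ u ^+ p = u /\ v ^+ p = v \/
  w ^+ p = w ^+ 2 /\ u ^+ p = v /\ v ^+ p = u.

Lemma frob_omega : w ^+ p = w \/ w ^+ p = w ^+ 2.
Proof.
have p_pr := pcharf_prime pF.
have : (p %% 3 = 1 \/ p %% 3 = 2)%N.
  have : ~~ (3 %| p)%N.
    rewrite dvdn_prime2 // eq_sym; move: n3.
    by rewrite (pchar_natr_eq0 _ pF) dvdn_prime2.
  by clear; lia.
by rewrite -(expr_mod p w3) => -[] ->; [left | right].
Qed.

(** Each root satisfies [a ^ p = C a + D]. By Fourier inversion [u ^ p] and [v ^ p] are [C u] and
    [C v] in some order; since [u v] and [u ^ 3 + v ^ 3] are integers, [C ^ 2 = 1] and
    [52 C ^ 3 = 52], so [C = 1]. *)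
Lemma berstel_eq0_frob : (berstel p)%:~R = 0 :> F -> frob_trivial.
Proof.
move=> Bp; have p_pr := pcharf_prime pF; have p_gt0 := prime_gt0 p_pr.
pose C : F := (berstel p.+1)%:~R; pose D : F := (4 * berstel p.-1)%:~R.
(* With [y = x u + x ^ 2 v = 3 a - 2], the relation [a ^ p = C a + D] becomes [y ^ p = C y + K]. *)
pose K := 2%:R * C + 3%:R * D - 2%:R.
have rootX x : x ^+ 3 = 1 ->
    (x * u + x ^+ 2 * v) ^+ p = x * (C * u) + x ^+ 2 * (C * v) + K.
  move=> x3; have := berstel_expr p.-1 (cardano_rootP x3).
  rewrite prednK // rmorphB rmorphM /= Bp mulr0 subr0 mul0r add0r -/C -/D => E.
  have -> : x * u + x ^+ 2 * v = 3%:R * cardano_root x - 2%:R.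
    by rewrite /cardano_root; field.
  rewrite frobD frobN exprMn !frob_natr E /K /cardano_root; field.
  exact: n3.
have coefs U V : U + V = C * u + C * v + K ->
    w * U + w ^+ 2 * V = w * (C * u) + w ^+ 2 * (C * v) + K ->
    w ^+ 2 * U + w * V = w ^+ 2 * (C * u) + w * (C * v) + K ->
    U = C * u /\ V = C * v.
  exact: omega_coef_inj n3 wP.
have w23 : (w ^+ 2) ^+ 3 = 1 by rewrite exprAC w3 expr1n.
have w4 : (w ^+ 2) ^+ 2 = w by rewrite -exprM (exprS _ 3) w3 mulr1.
set U := u ^+ p in coefs *; set V := v ^+ p in coefs *.
have rootP x : x ^+ 3 = 1 ->
    x ^+ p * U + (x ^+ p) ^+ 2 * V = x * (C * u) + x ^+ 2 * (C * v) + K.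
  move=> /rootX <-; rewrite frobD (exprMn p x u) (exprMn p (x ^+ 2) v).
  by rewrite (exprAC x 2 p).
have := rootP 1 (expr1n _ 3); rewrite !expr1n !mul1r => E0.
have E1 := rootP w w3.
have := rootP _ w23; rewrite (exprAC w 2 p) w4 => E2.
have uv8 : (- 8%:R : F) != 0.
  have n8 : 13%:R * 8%:R != 0 :> F by rewrite -natrM.
  by move: n8; rewrite mulf_eq0 negb_or oppr_eq0 => /andP[].
have [u0 v0] : u != 0 /\ v != 0.
  by apply/andP; rewrite -negb_or -mulf_eq0 uv.
have UV : U * V = u * v by rewrite -exprMn uv frobN frob_natr.
have U3V3 : U ^+ 3 + V ^+ 3 = 52%:R.
  by rewrite !(exprAC _ p 3) -frobD u3v3 frob_natr.
have C1 : U * V = C ^+ 2 * (u * v) -> U ^+ 3 + V ^+ 3 = C ^+ 3 * 52%:R -> C = 1.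
  rewrite UV U3V3 uv -[LHS]mul1r => /(mulIf uv8) C2; rewrite exprSr -C2 mul1r.
  move=> C52; have /eqP : (C - 1) * (C + 1) = 0.
    by rewrite -subr_sqr -C2 expr1n subrr.
  rewrite mulf_eq0 subr_eq0 addr_eq0 => /orP[/eqP //|/eqP CN].
  have /eqP : 104%:R = 0 :> F.
    transitivity (52%:R - C * 52%:R); first by rewrite CN; ring.
    by rewrite -C52 subrr.
  by rewrite (negPf n104).
case: frob_omega => wp; rewrite wp ?w4 in E1 E2; [left | right].
  have [Uu Vv] := coefs U V E0 E1 E2; rewrite wp.
  have C_1 : C = 1.
    apply: C1; first by rewrite Uu Vv; ring.
    by rewrite Uu Vv -u3v3; ring.
  by rewrite -/U -/V Uu Vv C_1 !mul1r.
have [Vu Uv] : V = C * u /\ U = C * v.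
  by apply: coefs; rewrite addrC ?E0 // ?E1 // E2.
have C_1 : C = 1.
  apply: C1; first by rewrite Uv Vu; ring.
  by rewrite Uv Vu -u3v3; ring.
by rewrite wp -/U -/V Uv Vu C_1 !mul1r.
Qed.

Lemma frob_berstel_eq0 :
  u ^+ 3 != v ^+ 3 -> frob_trivial -> (berstel p)%:~R = 0 :> F.
Proof.
move=> u3_v3 triv; have p_pr := pcharf_prime pF; have p_gt0 := prime_gt0 p_pr.
have fixed x : x = 1 \/ x = w \/ x = w ^+ 2 ->
    cardano_root x ^+ p = cardano_root x.
  move=> xE; have x3 : x ^+ 3 = 1.
    by case: xE => [|[]] ->; rewrite ?expr1n // exprAC w3 expr1n.
  rewrite /cardano_root expr_div_n (frob_natr 3) frobD (frob_natr 2) frobD.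
  rewrite (exprMn p x u) (exprMn p (x ^+ 2) v) (exprAC x 2 p).
  suff -> : x ^+ p * u ^+ p + (x ^+ p) ^+ 2 * v ^+ p = x * u + x ^+ 2 * v by [].
  case: triv => [[wp [-> ->]]|[wp [-> ->]]].
    have -> // : x ^+ p = x.
    by case: xE => [|[]] ->; rewrite ?expr1n // exprAC wp.
  have -> : x ^+ p = x ^+ 2.
    by case: xE => [|[]] ->; rewrite ?expr1n // exprAC wp.
  by rewrite -(exprM x 2 2) (exprS x 3) x3 mulr1 addrC.
(* As [a ^ p = a], all three roots annihilate [B X ^ 2 + C X + D]. Expanding 9 times this at
   [3 a = x u + x ^ 2 v + 2] gives the constant term [k] and the coefficients of [x] and [x ^ 2] in
   [eqn]; their vanishing yields [B (u ^ 3 - v ^ 3) = 0]. *)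
pose B : F := (berstel p)%:~R; pose C : F := (berstel p.+1)%:~R - 2%:R * B - 1.
pose D : F := (4 * berstel p.-1)%:~R; pose b := 4%:R * B + 3%:R * C.
pose k := 2%:R * B * (u * v) + 4%:R * B + 6%:R * C + 9%:R * D.
have eqn x : x = 1 \/ x = w \/ x = w ^+ 2 ->
    x * (B * v ^+ 2 + b * u) + x ^+ 2 * (B * u ^+ 2 + b * v) =
    x * 0 + x ^+ 2 * 0 + - k.
  move=> xE; have x3 : x ^+ 3 = 1.
    by case: xE => [|[]] ->; rewrite ?expr1n // exprAC w3 expr1n.
  have := berstel_expr p.-1 (cardano_rootP x3).
  rewrite prednK // fixed // rmorphB rmorphM /= -/B -/D => E.
  have E' : B * cardano_root x ^+ 2 + (C + 1) * cardano_root x + D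
      - cardano_root x = 0.
    by apply/eqP; rewrite subr_eq0; apply/eqP; rewrite [RHS]E /C; ring.
  rewrite !mulr0 !add0r; apply/eqP; rewrite -subr_eq0 opprK; apply/eqP.
  transitivity (9%:R * (B * cardano_root x ^+ 2 + (C + 1) * cardano_root x + D
      - cardano_root x) - (x ^+ 3 - 1) * B * (2%:R * u * v + x * v ^+ 2)).
    by rewrite /k /b /cardano_root; field.
  by rewrite E' x3 subrr !mul0r mulr0 subr0.
have := eqn 1 (or_introl erefl); rewrite !expr1n !mul1r => e0.
have e1 := eqn w (or_intror (or_introl erefl)).
have w4 : (w ^+ 2) ^+ 2 = w by rewrite -exprM (exprS _ 3) w3 mulr1.
have := eqn _ (or_intror (or_intror erefl)); rewrite w4 => e2.
have [h1 h2] := omega_coef_inj n3 wP e0 e1 e2.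
apply/eqP; have /eqP : B * (u ^+ 3 - v ^+ 3) = 0.
  transitivity (u * (B * u ^+ 2 + b * v) - v * (B * v ^+ 2 + b * u)).
    by ring.
  by rewrite h1 h2 !mulr0 subrr.
by rewrite mulf_eq0 subr_eq0 (negPf u3_v3) orbF.
Qed.

End Cardano.

(** Taking [v = - 8 / u] works because [(26 + 6 r) (26 - 6 r) = 676 - 36 * 33 = (- 8) ^ 3]. *)
Lemma cardano_radicals (F : closedFieldType) (r : F) :
  2%:R != 0 :> F -> r ^+ 2 = 33%:R ->
  exists u v : F, [/\ u * v = - 8%:R, u ^+ 3 = 26%:R + 6%:R * r &
                       v ^+ 3 = 26%:R - 6%:R * r].
Proof.
move=> n2 r2; have [|u uE] := @solve_monicpoly F 3 (nth 0 [:: 26%:R + 6%:R * r]).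
  by [].
have u3 : u ^+ 3 = 26%:R + 6%:R * r.
  by rewrite uE !big_ord_recr big_ord0 /= !mul0r mulr1 add0r !addr0.
have u3N : u ^+ 3 * (26%:R - 6%:R * r) = (- 8%:R) ^+ 3.
  transitivity (676%:R - 36%:R * r ^+ 2); first by rewrite u3; ring.
  by rewrite r2; ring.
have u30 : u ^+ 3 != 0.
  apply: contra_eq_neq u3N => ->.
  by rewrite mul0r eq_sym expf_eq0 oppr_eq0 (natrX _ 2 3) expf_eq0.
have u0 : u != 0 by move: u30; rewrite expf_eq0.
have uv : u * (- 8%:R / u) = - 8%:R by rewrite mulrC divfK.
exists u, (- 8%:R / u); split=> //.
by apply: (mulfI u30); rewrite -exprMn uv u3N.
Qed.

(** In [F], [c ^ 2 = - 11 d ^ 2], so [r = c sqrt (-3) / d] is a square root of 33 and [epsilon] over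
    its conjugate is [(u / v) ^ 3]. The symbol is thus [(u / v) ^ (p - 1)] or
    [(u / v) ^ (- (p + 1))], which compares [u ^ p / v ^ p] with [u / v] or [v / u]. *)
Lemma berstel_eq0_frob_symbol (p k : nat) (c d e : int) (F : closedFieldType)
    (w : F) :
  p \in [pchar F] -> ~~ (p %| 2 * 3 * 11 * 13)%N -> w ^+ 2 + w + 1 = 0 ->
  c ^+ 2 + 11 * d ^+ 2 = 4 * (k * p)%N%:Z -> 13 * d + 3 * c = 2 * e ->
  ~~ (p%:Z %| d)%Z ->
  (berstel p)%:~R = 0 :> F <-> frob_symbol w p e (3 * c) = 1.
Proof.
move=> pF pN wP cdk de pd; have p_pr := pcharf_prime pF.
have neq0 n : (n %| 2 * 3 * 11 * 13)%N -> n%:R != 0 :> F.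
  by move=> nN; rewrite (pchar_natr_eq0 _ pF); apply: contra pN => /dvdn_trans->.
have n2 : 2%:R != 0 :> F by apply: neq0.
have n3 : 3%:R != 0 :> F by apply: neq0.
have n8 : 8%:R != 0 :> F by rewrite (natrX _ 2 3) expf_neq0.
have d0 : d%:~R != 0 :> F by rewrite (pchar_intr_eq0 _ pF).
have cdF : c%:~R ^+ 2 = - 11%:R * d%:~R ^+ 2 :> F.
  have /(congr1 (fun z : int => z%:~R : F)) := cdk.
  have kp0 : (k * p)%N%:~R = 0 :> F by rewrite -pmulrn natrM (pcharf0 pF) mulr0.
  rewrite [in RHS]rmorphM /= kp0 mulr0 rmorphD rmorphXn rmorphM rmorphXn /=.
  by move/eqP; rewrite addr_eq0 => /eqP ->; rewrite mulNr.
pose r := c%:~R * (1 + 2%:R * w) / d%:~R.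
have w2 := omega_sqrE wP.
have r2 : r ^+ 2 = 33%:R.
  rewrite /r expr_div_n exprMn cdF.
  transitivity (- 11%:R * (4%:R * (w ^+ 2 + w + 1) - 3%:R) : F); first by field.
  by rewrite wP; ring.
have [u [v [uv u3 v3]]] := cardano_radicals n2 r2.
have [u0 v0] : u != 0 /\ v != 0.
  by apply/andP; rewrite -negb_or -mulf_eq0 uv oppr_eq0.
have u3v3 : u ^+ 3 + v ^+ 3 = 52%:R by rewrite u3 v3; ring.
have eE : 2%:R * e%:~R = 13%:R * d%:~R + 3%:R * c%:~R :> F.
  have /(congr1 (fun z : int => z%:~R : F)) := de.
  by rewrite rmorphD !rmorphM.
have AE : 4%:R * eis w e (3 * c) = d%:~R * u ^+ 3.
  rewrite u3 /r /eis rmorphM /=.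
  transitivity (2%:R * (2%:R * e%:~R) + 12%:R * c%:~R * w); first by ring.
  by rewrite eE; field.
have BE : 4%:R * eis (w ^+ 2) e (3 * c) = d%:~R * v ^+ 3.
  rewrite v3 /r /eis rmorphM /= w2.
  transitivity (2%:R * (2%:R * e%:~R) + 12%:R * c%:~R * (- w - 1)); first by ring.
  by rewrite eE; field.
have n4 : 4%:R != 0 :> F by rewrite (natrX _ 2 2) expf_neq0.
have ABE : eis w e (3 * c) / eis (w ^+ 2) e (3 * c) = (u / v) ^+ 3.
  have -> : eis w e (3 * c) = d%:~R * u ^+ 3 / 4%:R.
    by apply: (mulfI n4); rewrite AE; field.
  have -> : eis (w ^+ 2) e (3 * c) = d%:~R * v ^+ 3 / 4%:R.
    by apply: (mulfI n4); rewrite BE; field.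
  by field; rewrite v0 d0 n4.
have p_mod3 : (p %% 3 = 1 \/ p %% 3 = 2)%N.
  have : ~~ (3 %| p)%N.
    rewrite dvdn_prime2 // eq_sym; move: n3.
    by rewrite (pchar_natr_eq0 _ pF) dvdn_prime2.
  by clear; lia.
have w3 := cube_root1 wP.
have rX : r ^+ p = c%:~R * (1 + 2%:R * w ^+ p) / d%:~R.
  rewrite /r expr_div_n !exprMn (frob_intr pF c) (frob_intr pF d) (frobD pF).
  by rewrite exprMn expr1n (frob_natr pF 2).
have u3X : (u ^+ p) ^+ 3 = 26%:R + 6%:R * r ^+ p.
  by rewrite exprAC u3 (frobD pF) exprMn !(frob_natr pF).
have UV : u ^+ p * v ^+ p = u * v.
  by rewrite -exprMn uv (frobN pF) (frob_natr pF).
have uP0 : u ^+ p != 0 by rewrite expf_neq0.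
have vP0 : v ^+ p != 0 by rewrite expf_neq0.
have u3_neq_v3 : u ^+ 3 != v ^+ 3.
  rewrite -subr_eq0 (_ : _ - _ = 4%:R * 3%:R * r); last by rewrite u3 v3; ring.
  apply: mulf_neq0; first by rewrite mulf_neq0.
  by apply: contraTneq (neq0 33%N isT) => r0; rewrite -r2 r0 expr0n eqxx.
have w_neq_sqr : w != w ^+ 2.
  have w0 : w != 0.
    by apply: contra_eq_neq w3 => ->; rewrite expr0n eq_sym oner_eq0.
  apply: contra (omega_neq1 n3 wP) => /eqP ww.
  by apply/eqP/(mulfI w0); rewrite mulr1 [in RHS]ww expr2.
rewrite /frob_symbol /frob_exponent ABE; case: p_mod3 => pE.
  rewrite pE /= -exprnP -exprM; set n := ((p - 1) %/ 3)%N.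
  have pn : p = (3 * n).+1.
    by rewrite /n; clear -pE p_pr; have := prime_gt1 p_pr; lia.
  have wp : w ^+ p = w by rewrite -(expr_mod p w3) pE.
  have uvX : (u / v) ^+ (3 * n) = (u / v) ^+ p / (u / v).
    by rewrite [in RHS]pn exprSr mulfK // mulf_neq0 ?invr_neq0.
  rewrite uvX expr_div_n; split=> [Bp|T1].
    have [[_ [-> ->]]|[wp2 _]] := berstel_eq0_frob pF pN wP uv u3v3 Bp.
      by rewrite divff // mulf_neq0 ?invr_neq0.
    by move: w_neq_sqr; rewrite -wp2 wp eqxx.
  apply: (frob_berstel_eq0 pF pN wP uv u3v3).
    exact: u3_neq_v3.
  have rp : r ^+ p = r by rewrite rX wp.
  have Uv : u ^+ p * v = v ^+ p * u.
    apply/eqP; rewrite -subr_eq0; apply/eqP.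
    transitivity ((u ^+ p / v ^+ p / (u / v) - 1) * (v ^+ p * u)).
      by field; rewrite u0 v0 vP0.
    by rewrite T1 subrr mul0r.
  (* [u ^ p] and [u] have equal squares by [UV], and equal cubes because [r] is fixed, so they
     coincide. *)
  have U2 : (u ^+ p) ^+ 2 = u ^+ 2.
    by apply: (mulIf v0); rewrite expr2 -mulrA Uv mulrA UV; ring.
  have Uu : u ^+ p = u.
    by apply: (mulIf (expf_neq0 2 u0)); rewrite -exprS u3 -rp -u3X -U2 -exprS.
  have Vv : v ^+ p = v by apply: (mulfI u0); rewrite -UV Uu.
  by left.
rewrite pE /= -exprnN; set n := ((p + 1) %/ 3)%N.
have pn : (3 * n = p.+1)%N by rewrite /n; clear -pE; lia.
have wp : w ^+ p = w ^+ 2 by rewrite -(expr_mod p w3) pE.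
rewrite -exprM pn exprSr expr_div_n; split=> [Bp|].
  have [[wp1 _]|[_ [-> ->]]] := berstel_eq0_frob pF pN wP uv u3v3 Bp.
    by move: w_neq_sqr; rewrite -wp wp1 eqxx.
  by field; rewrite v0 u0 oner_eq0.
move/(congr1 GRing.inv); rewrite invrK invr1 => T1.
apply: (frob_berstel_eq0 pF pN wP uv u3v3 u3_neq_v3).
have rp : r ^+ p = - r by rewrite rX wp w2 /r; field.
have Uu : u ^+ p * u = v ^+ p * v.
  apply/eqP; rewrite -subr_eq0; apply/eqP.
  transitivity ((u ^+ p / v ^+ p * (u / v) - 1) * (v ^+ p * v)).
    by field; rewrite v0 vP0.
  by rewrite T1 subrr mul0r.
have U2 : (u ^+ p) ^+ 2 = v ^+ 2.
  by apply: (mulIf u0); rewrite expr2 -mulrA Uu mulrA UV; ring.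
have Uv : u ^+ p = v.
  apply: (mulIf (expf_neq0 2 v0)); rewrite -exprS v3 -mulrN -rp -u3X -U2.
  by rewrite -exprS.
have Vu : v ^+ p = u by apply: (mulfI v0); rewrite [RHS]mulrC -UV Uv.
by right.
Qed.

(** * Representation of 4 p by the norm form *)

(** Discriminant -11 has class number one: the form [(a, b, c)] arises from [X ^ 2 + X Y + 3 Y ^ 2]
    by the substitution with entries [x, y, z, t]. While [|b|] exceeds [a] or [c], a shear decreases
    [a + c]. *)
Lemma form11_reduction (a b c : int) : 0 < a -> 0 < c ->
  b ^+ 2 + 11 = 4 * a * c -> exists x y z t : int,
  [/\ a = x ^+ 2 + x * y + 3 * y ^+ 2, c = z ^+ 2 + z * t + 3 * t ^+ 2 &
      b = 2 * x * z + x * t + y * z + 6 * y * t].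
Proof.
have [n] := ubnP `|(a + c)%R|%N.
elim: n => // n IHn in a b c * => acn a_gt0 c_gt0 abc.
have step a' b' c' : a' + c' < a + c -> 0 < a' -> 0 < c' ->
    b' ^+ 2 + 11 = 4 * a' * c' -> exists x y z t : int,
    [/\ a' = x ^+ 2 + x * y + 3 * y ^+ 2, c' = z ^+ 2 + z * t + 3 * t ^+ 2 &
        b' = 2 * x * z + x * t + y * z + 6 * y * t].
  by move=> lt a'0 c'0; apply: IHn => //; clear -lt acn a'0 c'0; lia.
have pos (k l m : int) : 0 < l -> m ^+ 2 + 11 = 4 * l * k -> 0 < k.
  move=> l0 lk; rewrite -(pmulr_rgt0 _ l0).
    have := sqr_ge0 m; move: lk; rewrite -mulrA.
    by move: (m ^+ 2) (l * k) => A B; lia.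
have [ab|ba] := ltrP a b.
  have E : (b - 2 * a) ^+ 2 + 11 = 4 * a * (a - b + c).
    transitivity (b ^+ 2 + 11 - 4 * a * b + 4 * a ^+ 2); first by ring.
    by rewrite abc; ring.
  have lt : a + (a - b + c) < a + c by clear -ab; lia.
  have [x [y [z [t [aE cE bE]]]]] := step _ _ _ lt a_gt0 (pos _ _ _ a_gt0 E) E.
  exists x, y, (z + x), (t + y); split=> //.
    transitivity ((a - b + c) + (b - 2 * a) + a); first by ring.
    by rewrite cE bE aE; ring.
  transitivity ((b - 2 * a) + 2 * a); first by ring.
  by rewrite bE aE; ring.
have [bNa|aNb] := ltrP b (- a).
  have E : (b + 2 * a) ^+ 2 + 11 = 4 * a * (a + b + c).
    transitivity (b ^+ 2 + 11 + 4 * a * b + 4 * a ^+ 2); first by ring.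
    by rewrite abc; ring.
  have lt : a + (a + b + c) < a + c by clear -bNa; lia.
  have [x [y [z [t [aE cE bE]]]]] := step _ _ _ lt a_gt0 (pos _ _ _ a_gt0 E) E.
  exists x, y, (z - x), (t - y); split=> //.
    transitivity ((a + b + c) - (b + 2 * a) + a); first by ring.
    by rewrite cE bE aE; ring.
  transitivity ((b + 2 * a) - 2 * a); first by ring.
  by rewrite bE aE; ring.
have [cb|bc] := ltrP c b.
  have E : (b - 2 * c) ^+ 2 + 11 = 4 * c * (a - b + c).
    transitivity (b ^+ 2 + 11 - 4 * c * b + 4 * c ^+ 2); first by ring.
    by rewrite abc; ring.
  have lt : (a - b + c) + c < a + c by clear -cb; lia.
  have E' := etrans E (mulrAC _ _ _).
  have [x [y [z [t [aE cE bE]]]]] := step _ _ _ lt (pos _ _ _ c_gt0 E) c_gt0 E'.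
  exists (x + z), (y + t), z, t; split=> //.
    transitivity ((a - b + c) + (b - 2 * c) + c); first by ring.
    by rewrite aE bE cE; ring.
  transitivity ((b - 2 * c) + 2 * c); first by ring.
  by rewrite bE cE; ring.
have [bNc|cNb] := ltrP b (- c).
  have E : (b + 2 * c) ^+ 2 + 11 = 4 * c * (a + b + c).
    transitivity (b ^+ 2 + 11 + 4 * c * b + 4 * c ^+ 2); first by ring.
    by rewrite abc; ring.
  have lt : (a + b + c) + c < a + c by clear -bNc; lia.
  have E' := etrans E (mulrAC _ _ _).
  have [x [y [z [t [aE cE bE]]]]] := step _ _ _ lt (pos _ _ _ c_gt0 E) c_gt0 E'.
  exists (x - z), (y - t), z, t; split=> //.
    transitivity ((a + b + c) - (b + 2 * c) + c); first by ring.
    by rewrite aE bE cE; ring.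
  transitivity ((b + 2 * c) - 2 * c); first by ring.
  by rewrite bE cE; ring.
(* The form is now reduced; [b ^ 2 <= a c] gives [3 a c <= 11], leaving finitely many cases. *)
have bac : b * b <= a * c.
  have [b0|b0] := lerP 0 b; first exact: ler_pM.
  by rewrite -mulrNN; apply: ler_pM; clear -b0 aNb cNb; lia.
have ac3 : a * c <= 3.
  by move: abc bac; rewrite expr2 -mulrA; move: (b * b) (a * c) => A B; lia.
have ac0 : 0 < a * c by rewrite mulr_gt0.
have {step pos IHn} : (a = 1 /\ c = 3 \/ a = 3 /\ c = 1) /\ (b = 1 \/ b = - 1).
  clear acn; have a3 : a <= 3 by clear -ac3 c_gt0 a_gt0; nia.
  have c3 : c <= 3 by clear -ac3 c_gt0 a_gt0; nia.
  have b1 : -3 <= b <= 3 by clear -a3 ba aNb; lia.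
  move: abc; rewrite expr2; clear -a3 c3 a_gt0 c_gt0 b1.
  have : (a = 1 \/ a = 2 \/ a = 3) /\ (c = 1 \/ c = 2 \/ c = 3) /\
    (b = -3 \/ b = -2 \/ b = -1 \/ b = 0 \/ b = 1 \/ b = 2 \/ b = 3) by lia.
  by case=> [[->|[->|->]]
    [[->|[->|->]] [->|[->|[->|[->|[->|[->|->]]]]]]]]; lia.
case=> [[[-> ->]|[-> ->]] [->|->]].
- by exists 1, 0, 0, 1.
- by exists 1, 0, 0, (-1).
- by exists 0, 1, 1, 0.
- by exists 0, (-1), 1, 0.
Qed.

(** [X ^ p - X] has at most [p] roots, and the residues [0, ..., p - 1] supply them all. *)
Lemma frob_fixed_natr (p : nat) (F : fieldType) (s : F) :
  p \in [pchar F] -> s ^+ p = s -> exists n : nat, s = n%:R.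
Proof.
move=> pF sp; have p_gt1 := prime_gt1 (pcharf_prime pF).
pose ns : seq F := [seq n%:R | n <- iota 0 p].
have [/mapP[n _ ->]|s_ns] := boolP (s \in ns); first by exists n.
have size_p : size ('X^p - 'X : {poly F}) = p.+1.
  by rewrite size_polyDl size_polyXn // size_polyN size_polyX ltnS.
suff : (size (s :: ns) < size ('X^p - 'X : {poly F})%R)%N.
  by rewrite size_p /= size_map size_iota ltnn.
apply: max_poly_roots; first by rewrite -size_poly_eq0 size_p.
  rewrite /= rootE !hornerE sp subrr eqxx /=; apply/allP => _ /mapP[n _ ->].
  by rewrite rootE !hornerE (frob_natr pF) subrr.
rewrite /= s_ns map_inj_in_uniq ?iota_uniq // => m n; rewrite !mem_iota /=.
move=> mp np /eqP; rewrite -subr_eq0 !pmulrn -rmorphB (pchar_intr_eq0 _ pF).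
move=> mn; apply/eqP; rewrite -eqz_nat -subr_eq0 -absz_eq0.
apply: contraLR mn; rewrite -lt0n => mn; apply/negP => /(dvdn_leq mn).
by clear -mp np; lia.
Qed.

Lemma norm11_represent (p : nat) (z : int) : prime p -> p != 2%N ->
  (p%:Z %| z ^+ 2 + 11)%Z ->
  exists a b : int, a ^+ 2 + 11 * b ^+ 2 = 4 * p%:Z.
Proof.
move=> p_pr p2; have p_odd : odd p by case: (even_prime p_pr) p2 => // ->.
have p_gt0 := prime_gt0 p_pr.
(* Adding [p] changes the parity of [z]. For odd [z], [4 p] divides [z ^ 2 + 11], so [p] is the
   leading coefficient of a form of discriminant -11. *)
wlog z_odd : z / ~~ (2 %| z)%Z => [wl|] pz.
  have [z2|] := boolP (2 %| z)%Z; last by move/wl; apply.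
  apply: (wl (z + p%:Z)); first by clear -z2 p_odd; lia.
  rewrite (_ : _ + _ = z ^+ 2 + 11 + p%:Z * (2 * z + p%:Z)); last by ring.
  by apply: rpredD => //; apply: dvdz_mulr.
have : (4 * p%:Z %| z ^+ 2 + 11)%Z.
  rewrite Gauss_dvdz; last first.
    by rewrite coprimezE (coprimeXl 2 (_ : coprime 2 _)) // coprime2n absz_nat.
  rewrite pz andbT.
  have /dvdzP[y yE] : (2 %| z - 1)%Z by clear -z_odd; lia.
  rewrite (_ : _ + _ = 4 * (y ^+ 2 + y + 3)); first exact: dvdz_mulr.
  have -> : z = y * 2 + 1 by rewrite -yE; ring.
  by ring.
case/dvdzP => c zc.
have p0 : 0 < 4 * p%:Z by clear -p_gt0; lia.
have c_gt0 : 0 < c.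
  rewrite -(pmulr_lgt0 _ p0) -zc; have := sqr_ge0 z.
  by move: (z ^+ 2) => A; clear; lia.
rewrite mulrC in zc.
have [x [y [_ [_ [pE _ _]]]]] := form11_reduction (p_gt0 : 0 < p%:Z) c_gt0 zc.
by exists (2 * x + y), y; rewrite pE; ring.
Qed.

Lemma berstel_eq0_even (p : nat) (a b : int) (F : closedFieldType) :
  p \in [pchar F] -> ~~ (p %| 2 * 3 * 11 * 13)%N ->
  a ^+ 2 + 11 * b ^+ 2 = 4 * p%:Z ->
  (berstel p)%:~R = 0 :> F <-> (2 %| a)%Z.
Proof.
move=> pF pN ab; have p_pr := pcharf_prime pF; have [w wP] := omega_exists F.
have pN' : ~~ (p %| 2 * 3 * 11)%N by apply: contra pN => /dvdn_mulr->.
have cdk k c d : k = 1%N \/ k = 11%N -> (k%:Z %| c)%Z ->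
    c ^+ 2 + 11 * d ^+ 2 = 4 * (k * p)%N%:Z -> ~~ (3 %| d)%Z ->
    (berstel p)%:~R = 0 :> F <-> (2 %| c)%Z.
  move=> kP kc E d3.
  have /dvdzP[e de] : (2 %| 13 * d + 3 * c)%Z.
    suff : (2 %| (c + d) * (c + d))%Z by rewrite prime_dvdzM // orbb; clear; lia.
    rewrite (_ : _ * _ = c ^+ 2 + 11 * d ^+ 2 + 2 * (c * d - 5 * d ^+ 2)).
      by apply: rpredD; [rewrite E; apply/dvdz_mulr | apply: dvdz_mulr].
    by ring.
  rewrite [RHS]mulrC in de.
  have pd : ~~ (p%:Z %| d)%Z.
    apply/negP => /(no_common_prime_divisor p_pr pN' kP kc E p_pr); apply.
    exact: dvdn_mull.
  rewrite (berstel_eq0_frob_symbol pF pN wP E de pd).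
  have <- := frob_symbol_eq1 p_pr pN' kP kc E de d3 pF wP.
  by split=> [->|/eqP //]; rewrite eqxx.
have [b3|b3] := boolP (3 %| b)%Z; last first.
  by apply: (cdk 1%N) b3 => //; [left | rewrite mul1n].
have a3 : ~~ (3 %| a)%Z.
  apply/negP => a3; have : (3 * 3 %| 4 * p%:Z)%Z.
    rewrite -ab !expr2; apply: rpredD; first exact: dvdz_mul.
    by apply/dvdz_mull/dvdz_mul.
  move: pN'; rewrite !Euclid_dvdM // !dvdn_prime2 // !negb_or.
  case/andP=> /andP[_ p3] _ h; have : (3 %| p)%N by clear -h; lia.
  by rewrite dvdn_prime2 // eq_sym (negPf p3).
(* The criterion now concerns the parity of [11 b], which is that of [a] because [a ^ 2 + 11 b ^ 2]
   is even. *)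
rewrite (cdk 11%N (11 * b) a) //; [|by right|exact: dvdz_mulr|]; last first.
  rewrite PoszM (_ : 4 * _ = 11 * (4 * p%:Z)); last by ring.
  by rewrite -ab; ring.
have : (2 %| (a + b) * (a + b))%Z.
  rewrite (_ : _ * _ = a ^+ 2 + 11 * b ^+ 2 + 2 * (a * b - 5 * b ^+ 2)).
    by apply: rpredD; [rewrite ab; apply/dvdz_mulr | apply: dvdz_mulr].
  by ring.
by rewrite !prime_dvdzM // orbb; clear; lia.
Qed.

Theorem corollary11 (p : nat) (p_prime : prime p)
    (p_ndvd : ~~ (p %| 2 * 3 * 11 * 13)%N) :
  (berstel p = 0 %[mod p%:Z])%Z <->
  exists X Y : int, p%:Z = X ^+ 2 + 11 * Y ^+ 2.
Proof.
have [F pF] := closed_field_pchar p_prime.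
have p2 : p != 2%N by apply: contra p_ndvd => /eqP ->.
have BE : (berstel p = 0 %[mod p%:Z])%Z <-> (berstel p)%:~R = 0 :> F.
  split=> [/eqP|B0]; last apply/eqP.
    by rewrite eqz_mod_dvd subr0 dvdzE -(pchar_intr_eq0 _ pF) => /eqP.
  by rewrite eqz_mod_dvd subr0 dvdzE -(pchar_intr_eq0 _ pF) B0.
rewrite BE; split=> [B0|[X [Y pE]]]; last first.
  apply/(@berstel_eq0_even p (2 * X) (2 * Y) F pF p_ndvd); last exact: dvdz_mulr.
  by rewrite pE; ring.
(* Given such [a] and [b], [berstel_eq0_even] makes [a] even, hence [b] too, and halving represents
   [p]. *)
suff [a [b ab]] : exists a b : int, a ^+ 2 + 11 * b ^+ 2 = 4 * p%:Z.
  have /dvdzP[X aE] := proj1 (berstel_eq0_even pF p_ndvd ab) B0.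
  have /dvdzP[Y bE] : (2 %| b)%Z.
    have : (2 %| 11 * (b * b))%Z.
      rewrite (_ : _ * _ = 2 * (2 * p%:Z - 2 * X ^+ 2)); first exact: dvdz_mulr.
      transitivity (a ^+ 2 + 11 * b ^+ 2 - a ^+ 2); first by ring.
      by rewrite ab aE; ring.
    by rewrite !prime_dvdzM // orbb.
  exists X, Y; apply: (@mulfI _ (4 : int)) => //; rewrite -ab aE bE; ring.
have neq0 n : (n %| 2 * 3 * 11 * 13)%N -> n%:R != 0 :> F.
  move=> nN; rewrite (pchar_natr_eq0 _ pF).
  by apply: contra p_ndvd => /dvdn_trans->.
have n2 : 2%:R != 0 :> F by apply: neq0.
have [w wP] := omega_exists F.
have [|r rE] := @solve_monicpoly F 2 (nth 0 [:: 33%:R]); first by [].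
have r2 : r ^+ 2 = 33%:R.
  by rewrite rE !big_ord_recr big_ord0 /= !mul0r mulr1 add0r !addr0.
have [u [v [uv u3 v3]]] := cardano_radicals n2 r2.
have u3v3 : u ^+ 3 + v ^+ 3 = 52%:R by rewrite u3 v3; ring.
have triv := berstel_eq0_frob pF p_ndvd wP uv u3v3 B0.
have n3 : 3%:R != 0 :> F by apply: neq0.
have n6 : 6%:R != 0 :> F by rewrite (natrM _ 2 3) mulf_neq0.
have rX : 6%:R * r ^+ p = (u ^+ p) ^+ 3 - 26%:R.
  by rewrite exprAC u3 (frobD pF) exprMn !(frob_natr pF) addrC addKr.
have w2 := omega_sqrE wP.
(* A square root of -11, as [1 + 2 w] is one of -3. Frobenius fixes both [r] and [1 + 2 w] or
   negates both, so [s] lies in the prime field and -11 is a square modulo [p]. *)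
pose s := r * (1 + 2%:R * w) / 3%:R.
have s2 : s ^+ 2 = - 11%:R.
  rewrite /s expr_div_n exprMn r2.
  transitivity (33%:R * (4%:R * (w ^+ 2 + w + 1) - 3%:R) / 9%:R : F).
    have n9 : 9%:R != 0 :> F by rewrite (natrX _ 3 2) expf_neq0.
    by field; rewrite n9.
  rewrite wP; have n9 : 9%:R != 0 :> F by rewrite (natrX _ 3 2) expf_neq0.
  by field.
have sp : s ^+ p = s.
  have -> : s ^+ p = r ^+ p * (1 + 2%:R * w ^+ p) / 3%:R.
    rewrite /s expr_div_n (exprMn p r) (frobD pF) (exprMn p 2%:R) expr1n.
    by rewrite (frob_natr pF 2) (frob_natr pF 3).
  case: triv => [[-> [up _]]|[-> [up _]]].
    have -> // : r ^+ p = r.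
    by apply: (mulfI n6); rewrite rX up u3; ring.
  have -> : r ^+ p = - r by apply: (mulfI n6); rewrite rX up v3; ring.
  by rewrite w2 /s; field.
have [n sn] := frob_fixed_natr pF sp.
apply: (@norm11_represent p n%:Z) => //.
rewrite dvdzE -(pchar_intr_eq0 _ pF) rmorphD rmorphXn /= -pmulrn -sn s2.
by rewrite addNr.
Qed.
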